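(* Let $n\ge1$ be an integer. For the class $\mathcal{S}^*_n[C,D]$, the $\mathcal{S}^*_{\rho,n}$-radius is given by $$R_{\mathcal{S}^*_{\rho,n}}(\mathcal{S}^*_n[C,D]) = \begin{cases} \min\{1,R_1\}, & -1 \leq D < 0 < C \leq 1,\\ \min\{1,R_2\}, & 0 < D < C \leq 1,\end{cases}$$ where $$R_1 = \left( \frac{2\sinh^{-1}(1)}{C-D + \sqrt{(C-D)^2 + 4(D^2(1+\sinh^{-1}(1))-CD)\sinh^{-1}(1)}}\right)^{1/n}$$ and $$R_2 = \left( \frac{2\sinh^{-1}(1)}{C-D + \sqrt{(C-D)^2 + 4(D^2(\sinh^{-1}(1) - 1) + CD)\sinh^{-1}(1)}}\right)^{1/n}.$$
   Context: $\mathbb{D}=\{z\in\mathbb{C}:|z|<1\}$. For an integer $n\ge1$, $\mathcal{A}_n$ is the class of analytic functions $f$ on $\mathbb{D}$ of the form $f(z)=z+a_{n+1}z^{n+1}+a_{n+2}z^{n+2}+\cdots$, and $\mathcal{A}=\mathcal{A}_1$. For analytic $g,h$ on $\mathbb{D}$, $g\prec h$ (subordination) means $g=h\circ\omega$ for some analytic $\omega$ on $\mathbb{D}$ with $\omega(0)=0$ and $|\omega(z)|\le|z|$. $\sinh^{-1}(z)=\ln(z+\sqrt{1+z^2})$ is the principal branch (analytic in $\mathbb{D}$, $\sinh^{-1}(0)=0$). $\mathcal{S}^*_{\rho}=\{f\in\mathcal{A}: zf'(z)/f(z)\prec 1+\sinh^{-1}(z)\}$ and $\mathcal{S}^*_{\rho,n}=\mathcal{A}_n\cap\mathcal{S}^*_\rho$.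 For $-1\le D<C\le1$, $\mathcal{P}_n[C,D]$ is the class of analytic functions $p(z)=1+\sum_{k\ge n}c_kz^k$ on $\mathbb{D}$ with $p(z)\prec(1+Cz)/(1+Dz)$, and $\mathcal{S}^*_n[C,D]=\{f\in\mathcal{A}_n: zf'(z)/f(z)\in\mathcal{P}_n[C,D]\}$. For $G_1,G_2\subset\mathcal{A}$, the $G_1$-radius $R_{G_1}(G_2)$ of $G_2$ is the greatest number $r_0\in(0,1]$ such that for every $g\in G_2$ and every $0<r\le r_0$ the function $z\mapsto r^{-1}g(rz)$ belongs to $G_1$. *)

(* Defs.v *)
From Stdlib Require Import Reals Rpower Ratan.
From Coquelicot Require Import Coquelicot.
Open Scope R_scope.

(** Functions on the unit disk are represented by total functions [C -> C];
    every notion below only looks at their values on [in_disk]. *)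
Definition in_disk (z : C) : Prop := Cmod z < 1.

Definition analytic_on_disk (f : C -> C) : Prop :=
  forall z : C, in_disk z -> ex_derive (K := C_AbsRing) (V := C_NormedModule) f z.

Definition has_expansion (f : C -> C) (a : nat -> C) : Prop :=
  forall z : C, in_disk z ->
    is_pseries (K := C_AbsRing) (V := C_NormedModule) a z (f z).

(** [f(z) = z + a_{n+1} z^{n+1} + a_{n+2} z^{n+2} + ...] *)
Definition class_A (n : nat) (f : C -> C) : Prop :=
  analytic_on_disk f /\
  exists a : nat -> C,
    a 0%nat = RtoC 0 /\ a 1%nat = RtoC 1 /\
    (forall k : nat, (1 < k <= n)%nat -> a k = RtoC 0) /\
    has_expansion f a.

(** Subordination [g < h]; analyticity of [g] is required separately wherever
    this is used, and [h] is always one of the two analytic functions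
    [one_plus_asinh] and [mobius c d] below. *)
Definition subordinate (g h : C -> C) : Prop :=
  exists w : C -> C,
    analytic_on_disk w /\ w (RtoC 0) = RtoC 0 /\
    (forall z : C, in_disk z -> Cmod (w z) <= Cmod z) /\
    (forall z : C, in_disk z -> g z = h (w z)).

(** Principal argument, with values in (-PI, PI] (irrelevant at [z = 0]). *)
Definition Carg (z : C) : R :=
  if Rlt_dec (Im z) 0 then - acos (Re z / Cmod z) else acos (Re z / Cmod z).

Definition Cln (z : C) : C := (ln (Cmod z), Carg z).

(** Principal square root [|z|^(1/2) exp(i Arg z / 2)]. *)
Definition Csqrt (z : C) : C :=
  (RtoC (sqrt (Cmod z)) * (cos (Carg z / 2), sin (Carg z / 2)))%C.

Definition Casinh (z : C) : C := Cln (z + Csqrt (RtoC 1 + z * z))%C.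

Definition one_plus_asinh (z : C) : C := (RtoC 1 + Casinh z)%C.

Definition mobius (c d : R) (z : C) : C :=
  ((RtoC 1 + RtoC c * z) / (RtoC 1 + RtoC d * z))%C.

(** The function [z f'(z) / f(z)], with its removable singularity at the
    origin filled in: for [f] in [class_A n] with [n >= 1] the value there is 1. *)
Definition zf'_over_f (f : C -> C) (z : C) : C :=
  if Ceq_dec z (RtoC 0) then RtoC 1 else (z * C_derive f z / f z)%C.

(** [z f'(z) / f(z)] is a genuine analytic function on the disk: no division
    by zero occurs away from the origin. *)
Definition analytic_quotient (f : C -> C) : Prop :=
  (forall z : C, in_disk z -> z <> RtoC 0 -> f z <> RtoC 0) /\
  analytic_on_disk (zf'_over_f f).

Definition class_S_rho (f : C -> C) : Prop :=
  class_A 1 f /\ analytic_quotient f /\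
  subordinate (zf'_over_f f) one_plus_asinh.

Definition class_S_rho_n (n : nat) (f : C -> C) : Prop :=
  class_A n f /\ class_S_rho f.

Definition class_P (n : nat) (c d : R) (p : C -> C) : Prop :=
  analytic_on_disk p /\
  (exists b : nat -> C,
    b 0%nat = RtoC 1 /\
    (forall k : nat, (0 < k < n)%nat -> b k = RtoC 0) /\
    has_expansion p b) /\
  subordinate p (mobius c d).

Definition class_S (n : nat) (c d : R) (f : C -> C) : Prop :=
  class_A n f /\ analytic_quotient f /\ class_P n c d (zf'_over_f f).

Definition dilate (r : R) (g : C -> C) (z : C) : C :=
  (/ RtoC r * g (RtoC r * z))%C.

Definition radius_property (G1 G2 : (C -> C) -> Prop) (r0 : R) : Prop :=
  forall g : C -> C, G2 g ->
  forall r : R, 0 < r <= r0 -> G1 (dilate r g).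

(** [r0] is the [G1]-radius of [G2]. *)
Definition is_radius (G1 G2 : (C -> C) -> Prop) (r0 : R) : Prop :=
  (0 < r0 <= 1 /\ radius_property G1 G2 r0) /\
  (forall r : R, 0 < r <= 1 -> radius_property G1 G2 r -> r <= r0).

(** In [rho_R1] and [rho_R2] the base of the power is positive for the parameters
    concerned, so that [Rpower] is the usual n-th root. *)
Definition rho_R1 (n : nat) (c d : R) : R :=
  Rpower
    (2 * arcsinh 1 /
     (c - d + sqrt ((c - d) ^ 2
                    + 4 * (d ^ 2 * (1 + arcsinh 1) - c * d) * arcsinh 1)))
    (1 / INR n).

Definition rho_R2 (n : nat) (c d : R) : R :=
  Rpower
    (2 * arcsinh 1 /
     (c - d + sqrt ((c - d) ^ 2
                    + 4 * (d ^ 2 * (arcsinh 1 - 1) + c * d) * arcsinh 1)))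
    (1 / INR n).

(* Main.v *)
Require Import Defs.
From Stdlib Require Import Reals Arith Lra Lia Psatz.
From Stdlib Require Import ClassicalEpsilon FunctionalExtensionality.
From Coquelicot Require Import Coquelicot.
Open Scope R_scope.

(** Put [p = z f' / f] with [f] in the class [S n c d], and let [w] be such that
    [p = mobius c d w].  Since [p - 1] vanishes to order [n] at the origin, the maximum
    principle gives [|w z| <= |z|^n], hence [|p z - 1| <= (c - d) x / (1 - |d| x)] with
    [x = |z|^n].  Conversely [|sinh u| <= sinh |u|] shows that the disk
    [|u| < arcsinh 1] is mapped by [sinh] into the unit disk, so it is contained in the image
    of the unit disk under the inverse hyperbolic sine.  The two facts together give the lower
    bound for the radius: [(c - d) r^n / (1 - |d| r^n) <= arcsinh 1] is sufficient.  Both radii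
    of the statement are the root of this condition with equality, because the expressions
    under the square roots are the squares of [c - d + 2 |d| arcsinh 1].  Sharpness comes from
    [f = z (1 - |d| z^n)^(- beta)] with [n |d| beta = s (c - d)], [s = - sign d], for which
    [p = mobius c d (s z^n)]. *)

(** * Power series on the unit disk *)

(** The class definitions provide a power series for [p], whereas [w] is only known to be complex
    differentiable. So [w] is never expanded: writing [p = 1 + z ^ n q], the Moebius relation turns
    [w / z ^ n] into [q / (c - d p)], a quotient of two power series. Such a quotient has a
    second-order expansion at every point of the disk, and that alone yields a maximum principle
    through four-point means, with no contour integral and no power series of the quotient. Both
    signs of [d] lead to the same sharp constant because the image of [one_plus_asinh] is left at
    [1 + arcsinh 1] and at [1 - arcsinh 1] alike. The sign [s] makes the denominator of
    [mobius c d (s x)] equal to [1 - |d| x] for real [x > 0], so that the bound on [|p - 1|] is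
    attained at a real value, above or below 1. The complex power in the extremal function is given
    by its Taylor coefficients and handled through a differential equation, so no branch has to be
    chosen. *)

Lemma locally_Cmod (z : C) (P : C -> Prop) :
  locally (T := C_UniformSpace) z P <->
  exists del : posreal, forall y, Cmod (y - z) < del -> P y.
Proof.
  split.
  - intros [e He]. exists e. intros y Hy. apply He.
    now apply C_NormedModule_mixin_compat1.
  - intros [e He].
    (* Balls of [C_UniformSpace] are coordinatewise squares; the one of size [e / sqrt 2] lies in
       the disk of radius [e]. *)
    assert (Hs : 0 < sqrt 2) by (apply sqrt_lt_R0; lra).
    assert (Hp : 0 < e / sqrt 2).
    { apply Rdiv_lt_0_compat; [apply cond_pos | exact Hs]. }
    exists (mkposreal _ Hp). intros y Hy. apply He.
    replace (pos e) with (sqrt 2 * (mkposreal _ Hp)) by (simpl; field; lra).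
    now apply C_NormedModule_mixin_compat2.
Qed.

Lemma Cmod_sum_n (a : nat -> C) (n : nat) :
  Cmod (sum_n (G := C_AbelianMonoid) a n) <= sum_n (fun k => Cmod (a k)) n.
Proof.
  induction n as [|n IH].
  - rewrite !sum_O. apply Rle_refl.
  - rewrite !sum_Sn.
    eapply Rle_trans; [apply Cmod_triangle|].
    apply Rplus_le_compat_r, IH.
Qed.

Lemma filterlim_Cmod (u : nat -> C) (l : C) :
  filterlim u eventually (locally (T := C_UniformSpace) l) <->
  forall eps : posreal, exists N, forall n, (N <= n)%nat -> Cmod (u n - l) < eps.
Proof.
  split.
  - intros H eps. apply (H (fun y => Cmod (y - l) < eps)).
    apply locally_Cmod. now exists eps.
  - intros H P HP. apply locally_Cmod in HP. destruct HP as [e He].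
    destruct (H e) as [N HN]. exists N. intros n Hn. apply He, HN, Hn.
Qed.

Lemma filterlim_Cmod_0 (u : nat -> C) (l : C) :
  is_lim_seq (fun n => Cmod (u n - l)) 0 ->
  filterlim u eventually (locally (T := C_UniformSpace) l).
Proof.
  intros H. apply filterlim_Cmod. intros eps.
  apply is_lim_seq_spec in H. destruct (H eps) as [N HN].
  exists N. intros n Hn. specialize (HN n Hn). simpl in HN.
  rewrite Rminus_0_r, Rabs_pos_eq in HN by apply Cmod_ge_0. exact HN.
Qed.

Lemma pow_n_Cpow (z : C) (k : nat) : pow_n (K := C_Ring) z k = (z ^ k)%C.
Proof. induction k as [|k IH]; [reflexivity | simpl; now rewrite IH]. Qed.

Definition psum (a : nat -> C) (z : C) (n : nat) : C :=
  sum_n (G := C_AbelianMonoid) (fun k => (z ^ k * a k)%C) n.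

Lemma is_pseries_C (a : nat -> C) (z l : C) :
  is_pseries (K := C_AbsRing) (V := C_NormedModule) a z l <->
  filterlim (psum a z) eventually (locally (T := C_UniformSpace) l).
Proof.
  unfold is_pseries, is_series, psum. split; apply filterlim_ext; intros n;
  apply sum_n_ext; intros k; [|symmetry];
  exact (f_equal (fun w => (w * a k)%C) (pow_n_Cpow z k)).
Qed.

(** This says that the radius of convergence is at least 1. The form is chosen because it passes
    easily to shifts, to factors [k] and to difference quotients. *)
Definition coef_bounded (a : nat -> C) : Prop :=
  forall s, 0 <= s < 1 -> exists K, forall k, Cmod (a k) * s ^ k <= K.

Lemma coef_bounded_of_expansion (f : C -> C) (a : nat -> C) :
  has_expansion f a -> coef_bounded a.
Proof.
  intros H s Hs.
  assert (Hd : in_disk (RtoC s)).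
  { unfold in_disk. rewrite Cmod_R, Rabs_pos_eq; lra. }
  specialize (H _ Hd). apply (proj1 (is_pseries_C _ _ _)) in H.
  destruct (filterlim_bounded (V := C_NormedModule) (psum a (RtoC s))
              (ex_intro (fun l => filterlim (psum a (RtoC s)) eventually
                (locally (T := C_UniformSpace) l)) _ H)) as [M HM].
  exists (2 * M). intros k.
  assert (HM' : forall n, Cmod (psum a (RtoC s) n) <= M) by apply HM.
  assert (HM0 : 0 <= M) by (eapply Rle_trans; [apply Cmod_ge_0 | apply (HM' 0%nat)]).
  replace (Cmod (a k) * s ^ k) with (Cmod (RtoC s ^ k * a k)%C).
  2:{ rewrite Cmod_mult, Cmod_pow, Cmod_R, Rabs_pos_eq by lra. ring. }
  destruct k as [|k].
  - specialize (HM' 0%nat). unfold psum in HM'. rewrite sum_O in HM'. lra.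
  - replace (RtoC s ^ S k * a (S k))%C with (psum a (RtoC s) (S k) - psum a (RtoC s) k)%C.
    2:{ unfold psum. rewrite sum_Sn. change plus with Cplus. ring. }
    unfold Cminus. eapply Rle_trans; [apply Cmod_triangle|].
    rewrite Cmod_opp. generalize (HM' k) (HM' (S k)). lra.
Qed.

(** The bound at some [t] strictly between [s] and 1 leaves a convergent geometric series of ratio
    [s / t]. *)
Lemma coef_bounded_summable (a : nat -> C) (s : R) :
  coef_bounded a -> 0 <= s < 1 -> ex_series (fun k => Cmod (a k) * s ^ k).
Proof.
  intros H Hs. set (t := (1 + s) / 2).
  assert (Ht : s < t < 1) by (unfold t; lra).
  destruct (H t) as [K HK]; [lra|].
  apply (ex_series_le (K := R_AbsRing) (V := R_CompleteNormedModule) _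
           (fun k => (s / t) ^ k * K)).
  - intros k. change (norm ?x) with (Rabs x).
    rewrite Rabs_pos_eq.
    2:{ apply Rmult_le_pos; [apply Cmod_ge_0 | apply pow_le; lra]. }
    replace (s ^ k) with ((s / t) ^ k * t ^ k).
    2:{ rewrite <- Rpow_mult_distr. f_equal. field. lra. }
    replace (Cmod (a k) * ((s / t) ^ k * t ^ k))
      with ((s / t) ^ k * (Cmod (a k) * t ^ k)) by ring.
    apply Rmult_le_compat_l; [|apply HK].
    apply pow_le. apply Rdiv_le_0_compat; lra.
  - apply ex_series_scal_r, ex_series_geom.
    rewrite Rabs_pos_eq by (apply Rdiv_le_0_compat; lra).
    apply Rlt_div_l; lra.
Qed.

Lemma coef_bounded_ex (a : nat -> C) (z : C) :
  coef_bounded a -> in_disk z ->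
  exists l, is_pseries (K := C_AbsRing) (V := C_NormedModule) a z l.
Proof.
  intros H Hz.
  apply (ex_series_le (K := C_AbsRing) (V := C_CompleteNormedModule) _
           (fun k => Cmod (a k) * Cmod z ^ k)).
  - intros k. change (Cmod (pow_n (K := C_Ring) z k * a k)%C <= Cmod (a k) * Cmod z ^ k).
    rewrite pow_n_Cpow, Cmod_mult, Cmod_pow. lra.
  - apply coef_bounded_summable; [exact H|].
    split; [apply Cmod_ge_0 | exact Hz].
Qed.

(** A total function: where the series diverges the value is an arbitrary one chosen by
    [epsilon]. *)
Definition csum (a : nat -> C) (z : C) : C :=
  epsilon (inhabits (RtoC 0))
    (fun l => is_pseries (K := C_AbsRing) (V := C_NormedModule) a z l).

Lemma csum_correct (a : nat -> C) : coef_bounded a -> has_expansion (csum a) a.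
Proof.
  intros H z Hz. unfold csum. apply epsilon_spec. now apply coef_bounded_ex.
Qed.

Lemma filterlim_C_unique (u : nat -> C) (l l' : C) :
  filterlim u eventually (locally (T := C_UniformSpace) l) ->
  filterlim u eventually (locally (T := C_UniformSpace) l') -> l = l'.
Proof.
  intros H H'.
  exact (filterlim_locally_unique (K := C_AbsRing) (V := C_NormedModule) u l l' H H').
Qed.

Lemma has_expansion_unique (f g : C -> C) (a : nat -> C) (z : C) :
  has_expansion f a -> has_expansion g a -> in_disk z -> f z = g z.
Proof.
  intros Hf Hg Hz. specialize (Hf z Hz). specialize (Hg z Hz).
  apply (proj1 (is_pseries_C _ _ _)) in Hf. apply (proj1 (is_pseries_C _ _ _)) in Hg.
  exact (filterlim_C_unique _ _ _ Hf Hg).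
Qed.

Lemma has_expansion_csum (f : C -> C) (a : nat -> C) (z : C) :
  has_expansion f a -> in_disk z -> f z = csum a z.
Proof.
  intros Hf. apply (has_expansion_unique _ _ a); [exact Hf|].
  apply csum_correct. now apply (coef_bounded_of_expansion f).
Qed.

Lemma coef_bounded_shift (a : nat -> C) (m : nat) :
  coef_bounded a -> coef_bounded (fun k => a (m + k)%nat).
Proof.
  intros H s Hs.
  set (t := (1 + s) / 2). destruct (H t) as [K HK]; [unfold t; lra|].
  exists (K / t ^ m). intros k.
  assert (Ht : 0 < t) by (unfold t; lra).
  assert (Hm : 0 < t ^ m) by now apply pow_lt.
  apply (proj1 (Rle_div_r _ _ _ Hm)).
  eapply Rle_trans; [|apply (HK (m + k)%nat)].
  rewrite pow_add.
  replace (Cmod (a (m + k)%nat) * (t ^ m * t ^ k))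
    with (Cmod (a (m + k)%nat) * t ^ k * t ^ m) by ring.
  apply Rmult_le_compat_r; [lra|].
  apply Rmult_le_compat_l; [apply Cmod_ge_0|].
  apply pow_incr. unfold t; lra.
Qed.

Lemma psum_S (a : nat -> C) (z : C) (n : nat) :
  psum a z (S n) = (a 0%nat + z * psum (fun k => a (S k)) z n)%C.
Proof.
  induction n as [|n IH].
  - unfold psum. rewrite sum_Sn, !sum_O. change plus with Cplus. simpl. ring.
  - unfold psum in *. rewrite sum_Sn, IH, (sum_Sn _ n).
    change plus with Cplus. simpl. ring.
Qed.

Lemma filterlim_C_affine (u : nat -> C) (l a b : C) :
  filterlim u eventually (locally (T := C_UniformSpace) l) ->
  filterlim (fun n => (a + b * u n)%C) eventually
    (locally (T := C_UniformSpace) (a + b * l)%C).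
Proof.
  intros H.
  apply (filterlim_comp_2 (F := eventually) (fun _ => a) (fun n => (b * u n)%C) Cplus
           (filterlim_const a)
           (filterlim_comp _ _ _ u (fun w => (b * w)%C) _ _ _ H
              (filterlim_scal_r (K := C_AbsRing) (V := C_NormedModule) b l))
           (filterlim_plus (K := C_AbsRing) (V := C_NormedModule) a (b * l)%C)).
Qed.

Lemma csum_step (a : nat -> C) (z : C) :
  coef_bounded a -> in_disk z ->
  csum a z = (a 0%nat + z * csum (fun k => a (S k)) z)%C.
Proof.
  intros H Hz.
  pose proof (csum_correct _ H z Hz) as H1.
  pose proof (csum_correct _ (coef_bounded_shift a 1 H) z Hz) as H2.
  apply (proj1 (is_pseries_C _ _ _)) in H1. apply (proj1 (is_pseries_C _ _ _)) in H2. simpl in H2.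
  apply (filterlim_C_unique (fun n => psum a z (S n))).
  - apply (filterlim_comp _ _ _ S (psum a z) _ eventually); [|exact H1].
    apply eventually_subseq. intros n. lia.
  - eapply filterlim_ext; [intros n; symmetry; apply psum_S|].
    now apply filterlim_C_affine.
Qed.

Lemma csum_bound (a : nat -> C) (z : C) (s : R) :
  coef_bounded a -> Cmod z <= s < 1 ->
  Cmod (csum a z) <= Series (fun k => Cmod (a k) * s ^ k).
Proof.
  intros H Hs.
  assert (Hz : in_disk z) by (unfold in_disk; lra).
  pose proof (csum_correct _ H z Hz) as H1. apply (proj1 (is_pseries_C _ _ _)) in H1.
  assert (Hs0 : 0 <= s) by (eapply Rle_trans; [apply Cmod_ge_0 | apply Hs]).
  pose proof (coef_bounded_summable a s H ltac:(lra)) as Hsum.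
  apply Series_correct in Hsum.
  assert (Hle : forall n, Cmod (psum a z n) <= Series (fun k => Cmod (a k) * s ^ k)).
  { intros n. eapply Rle_trans; [apply Cmod_sum_n|].
    apply Rle_trans with (sum_n (fun k => Cmod (a k) * s ^ k) n).
    - rewrite !sum_n_Reals. apply sum_Rle. intros k _.
      rewrite Cmod_mult, Cmod_pow, Rmult_comm.
      apply Rmult_le_compat_l; [apply Cmod_ge_0|].
      apply pow_incr. split; [apply Cmod_ge_0 | lra].
    - apply (is_lim_seq_incr_compare (sum_n (fun k => Cmod (a k) * s ^ k))).
      + exact Hsum.
      + intros m. rewrite sum_Sn. change plus with Rplus.
        assert (0 <= Cmod (a (S m)) * s ^ S m).
        { apply Rmult_le_pos; [apply Cmod_ge_0 | now apply pow_le]. }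
        lra. }
  apply Rnot_lt_le. intros Hlt.
  destruct (proj1 (filterlim_Cmod _ _) H1 (mkposreal _ (proj2 (Rlt_0_minus _ _) Hlt)))
    as [N HN].
  specialize (HN N (Nat.le_refl N)). simpl in HN. specialize (Hle N).
  assert (Htri : Cmod (csum a z) <= Cmod (psum a z N) + Cmod (psum a z N - csum a z)).
  { replace (csum a z) with (psum a z N + - (psum a z N - csum a z))%C at 1 by ring.
    eapply Rle_trans; [apply Cmod_triangle|]. rewrite Cmod_opp. lra. }
  lra.
Qed.

(* Coefficients of the difference quotient (f z - f z0) / (z - z0). *)
Definition dq_coef (b : nat -> C) (z0 : C) (k : nat) : C :=
  csum (fun i => b (S k + i)%nat) z0.

Lemma dq_coef_step (b : nat -> C) (z0 : C) (k : nat) :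
  coef_bounded b -> in_disk z0 ->
  dq_coef b z0 k = (b (S k) + z0 * dq_coef b z0 (S k))%C.
Proof.
  intros Hb Hz0. unfold dq_coef. rewrite csum_step; auto using coef_bounded_shift.
  rewrite Nat.add_0_r. f_equal. f_equal. f_equal.
  apply functional_extensionality. intros i. f_equal. lia.
Qed.

(** For [t] at least [s] and [|z0|], multiplying the coefficient of index [k] by [t ^ S k] turns its
    estimate into a tail of the series of [|b k| t ^ k], whose sum [A] does not depend on [k]. *)
Lemma dq_coef_bounded (b : nat -> C) (z0 : C) :
  coef_bounded b -> in_disk z0 -> coef_bounded (dq_coef b z0).
Proof.
  intros Hb Hz0 s Hs.
  assert (Ht : exists t, s <= t /\ Cmod z0 <= t /\ 0 < t < 1).
  { exists ((1 + Rmax s (Cmod z0)) / 2).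
    pose proof (Rmax_l s (Cmod z0)). pose proof (Rmax_r s (Cmod z0)).
    assert (Rmax s (Cmod z0) < 1) by (apply Rmax_lub_lt; [lra | exact Hz0]).
    lra. }
  destruct Ht as (t & Hst & Hzt & Ht).
  set (A := Series (fun k => Cmod (b k) * t ^ k)).
  exists (A / t). intros k.
  assert (Hk : Cmod (dq_coef b z0 k) * t ^ S k <= A).
  { apply Rle_trans with (Series (fun i => Cmod (b (S k + i)%nat) * t ^ (S k + i))).
    - apply Rle_trans with
        (t ^ S k * Series (fun i => Cmod (b (S k + i)%nat) * t ^ i)).
      + rewrite Rmult_comm. apply Rmult_le_compat_l; [apply pow_le; lra|].
        apply csum_bound; [now apply coef_bounded_shift | lra].
      + rewrite <- Series_scal_l. right. apply Series_ext. intros i.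
        rewrite (pow_add t (S k) i). ring.
    - unfold A. rewrite (Series_incr_n (fun k => Cmod (b k) * t ^ k) (S k)).
      + assert (0 <= sum_f_R0 (fun k0 => Cmod (b k0) * t ^ k0) (Nat.pred (S k))).
        { apply cond_pos_sum. intros i.
          apply Rmult_le_pos; [apply Cmod_ge_0 | apply pow_le; lra]. }
        lra.
      + lia.
      + apply coef_bounded_summable; [exact Hb | lra]. }
  apply (Rle_div_r _ _ t ltac:(lra)).
  eapply Rle_trans; [|exact Hk]. simpl.
  replace (Cmod (dq_coef b z0 k) * (t * t ^ k)) with
    (Cmod (dq_coef b z0 k) * t ^ k * t) by ring.
  apply Rmult_le_compat_r; [lra|].
  apply Rmult_le_compat_l; [apply Cmod_ge_0|].
  apply pow_incr; lra.
Qed.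

(** The recursion [z0 c_(k+1) = c_k - b_(k+1)] makes the product telescope; the last summand is a
    remainder that vanishes in the limit. *)
Lemma dq_coef_telescope (b : nat -> C) (z0 z : C) (n : nat) :
  coef_bounded b -> in_disk z0 ->
  ((z - z0) * psum (dq_coef b z0) z n)%C =
  (psum b z n - csum b z0 + z * (z ^ n * dq_coef b z0 n))%C.
Proof.
  intros Hb Hz0.
  assert (Hc : forall k, (z0 * dq_coef b z0 (S k) = dq_coef b z0 k - b (S k))%C).
  { intros k. rewrite (dq_coef_step b z0 k Hb Hz0). ring. }
  assert (Hc0 : (z0 * dq_coef b z0 0 = csum b z0 - b 0%nat)%C).
  { rewrite (csum_step b z0 Hb Hz0). unfold dq_coef. simpl. ring. }
  induction n as [|n IH].
  - unfold psum. rewrite !sum_O. simpl.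
    replace ((z - z0) * (1 * dq_coef b z0 0))%C
      with (z * dq_coef b z0 0 - z0 * dq_coef b z0 0)%C by ring.
    rewrite Hc0. ring.
  - unfold psum in *. rewrite !sum_Sn. change plus with Cplus.
    rewrite Cmult_plus_distr_l, IH.
    replace ((z - z0) * (z ^ S n * dq_coef b z0 (S n)))%C
      with (z ^ S n * (z * dq_coef b z0 (S n) - z0 * dq_coef b z0 (S n)))%C by ring.
    rewrite Hc. simpl. ring.
Qed.

(** Each of the [k] terms of [1 + v + ... + v ^ (k - 1)] is at least [v ^ k]. This absorbs the
    factor [k] created by differentiation. *)
Lemma INR_pow_le (v : R) (k : nat) :
  0 <= v < 1 -> INR k * v ^ k * (1 - v) <= 1 - v ^ k.
Proof.
  intros Hv. induction k as [|k IH]; [simpl; lra|].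
  rewrite S_INR. simpl.
  assert (0 <= v ^ k <= 1).
  { split; [apply pow_le; lra|]. rewrite <- (pow1 k). apply pow_incr; lra. }
  assert (v * (INR k * v ^ k * (1 - v)) <= v * (1 - v ^ k))
    by (apply Rmult_le_compat_l; lra).
  assert (0 <= (1 - v) * (1 - v * v ^ k)) by (apply Rmult_le_pos; nra).
  lra.
Qed.

Lemma coef_bounded_INR (a : nat -> C) :
  coef_bounded a -> coef_bounded (fun k => (RtoC (INR k) * a k)%C).
Proof.
  intros Ha s Hs. set (t := (1 + s) / 2).
  assert (Ht : s < t < 1) by (unfold t; lra).
  destruct (Ha t ltac:(lra)) as [K HK].
  assert (Hq : 0 <= s / t < 1).
  { split; [apply Rdiv_le_0_compat; lra | apply Rlt_div_l; lra]. }
  exists (K * / (1 - s / t)). intros k.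
  rewrite Cmod_mult, Cmod_R, Rabs_pos_eq by apply pos_INR.
  replace (s ^ k) with ((s / t) ^ k * t ^ k).
  2:{ rewrite <- Rpow_mult_distr. f_equal. field. lra. }
  replace (INR k * Cmod (a k) * ((s / t) ^ k * t ^ k))
    with (Cmod (a k) * t ^ k * (INR k * (s / t) ^ k)) by ring.
  apply Rmult_le_compat; [| |apply HK|].
  - apply Rmult_le_pos; [apply Cmod_ge_0 | apply pow_le; lra].
  - apply Rmult_le_pos; [apply pos_INR | now apply pow_le].
  - apply Rmult_le_reg_r with (1 - s / t); [lra|].
    rewrite Rinv_l by lra.
    eapply Rle_trans; [now apply INR_pow_le|].
    assert (0 <= (s / t) ^ k) by now apply pow_le. lra.
Qed.

Lemma coef_term_lim (a : nat -> C) (z : C) :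
  coef_bounded a -> in_disk z ->
  filterlim (fun n => (z ^ n * a n)%C) eventually
    (locally (T := C_UniformSpace) (RtoC 0)).
Proof.
  intros Ha Hz. apply filterlim_Cmod_0.
  apply (is_lim_seq_ext (fun n => Cmod (a n) * Cmod z ^ n)).
  - intros n. replace (z ^ n * a n - 0)%C with (z ^ n * a n)%C by ring.
    rewrite Cmod_mult, Cmod_pow. ring.
  - apply ex_series_lim_0, coef_bounded_summable; [exact Ha|].
    split; [apply Cmod_ge_0 | exact Hz].
Qed.

Lemma csum_dq (b : nat -> C) (z0 z : C) :
  coef_bounded b -> in_disk z0 -> in_disk z ->
  csum b z = (csum b z0 + (z - z0) * csum (dq_coef b z0) z)%C.
Proof.
  intros Hb Hz0 Hz.
  pose proof (dq_coef_bounded b z0 Hb Hz0) as Hc.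
  pose proof (csum_correct _ Hb z Hz) as H1. apply (proj1 (is_pseries_C _ _ _)) in H1.
  pose proof (csum_correct _ Hc z Hz) as H2. apply (proj1 (is_pseries_C _ _ _)) in H2.
  pose proof (coef_term_lim _ z Hc Hz) as H3.
  apply (filterlim_C_unique (psum b z)); [exact H1|].
  apply (filterlim_C_affine _ _ (csum b z0) (z - z0)) in H2.
  apply (filterlim_C_affine _ _ (RtoC 0) (- z)) in H3.
  pose proof (filterlim_comp_2 (F := eventually) _ _ Cplus H2 H3
    (filterlim_plus (K := C_AbsRing) (V := C_NormedModule) _ _)) as H4.
  change plus with Cplus in H4.
  replace (csum b z0 + (z - z0) * csum (dq_coef b z0) z + (0 + - z * 0))%C
    with (csum b z0 + (z - z0) * csum (dq_coef b z0) z)%C in H4 by ring.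
  eapply filterlim_ext; [|exact H4]. intros n. simpl.
  rewrite (dq_coef_telescope b z0 z n Hb Hz0). ring.
Qed.

(** * Termwise differentiation of power series *)

Definition PS_derive_C (a : nat -> C) (k : nat) : C := (RtoC (INR (S k)) * a (S k))%C.

Lemma coef_bounded_derive (a : nat -> C) :
  coef_bounded a -> coef_bounded (PS_derive_C a).
Proof. intros Ha. exact (coef_bounded_shift _ 1 (coef_bounded_INR a Ha)). Qed.

(* Abel summation, using dq_coef b z k - z * dq_coef b z (S k) = b (S k). *)
Lemma psum_dq_diag (b : nat -> C) (z : C) (n : nat) :
  coef_bounded b -> in_disk z ->
  psum (dq_coef b z) z n =
  (psum (PS_derive_C b) z n + z * (z ^ n * (RtoC (INR (S n)) * dq_coef b z (S n))))%C.
Proof.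
  intros Hb Hz. unfold PS_derive_C.
  induction n as [|n IH].
  - unfold psum. rewrite !sum_O. rewrite (dq_coef_step b z 0 Hb Hz). simpl. ring.
  - unfold psum in *. rewrite !sum_Sn, IH. change plus with Cplus.
    rewrite (dq_coef_step b z (S n) Hb Hz), (S_INR (S n)), RtoC_plus. simpl Cpow. ring.
Qed.

Lemma csum_dq_diag (b : nat -> C) (z : C) :
  coef_bounded b -> in_disk z ->
  csum (dq_coef b z) z = csum (PS_derive_C b) z.
Proof.
  intros Hb Hz.
  pose proof (dq_coef_bounded b z Hb Hz) as Hc.
  pose proof (csum_correct _ Hc z Hz) as H1. apply (proj1 (is_pseries_C _ _ _)) in H1.
  pose proof (csum_correct _ (coef_bounded_derive _ Hb) z Hz) as H2.
  apply (proj1 (is_pseries_C _ _ _)) in H2.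
  pose proof (coef_term_lim _ z (coef_bounded_derive _ Hc) Hz) as H3.
  apply (filterlim_C_unique (psum (dq_coef b z) z)); [exact H1|].
  apply (filterlim_C_affine _ _ (RtoC 0) z) in H3.
  pose proof (filterlim_comp_2 (F := eventually) _ _ Cplus H2 H3
    (filterlim_plus (K := C_AbsRing) (V := C_NormedModule) _ _)) as H4.
  change plus with Cplus in H4.
  replace (csum (PS_derive_C b) z + (0 + z * 0))%C
    with (csum (PS_derive_C b) z)%C in H4 by ring.
  eapply filterlim_ext; [|exact H4]. intros n. simpl.
  rewrite (psum_dq_diag b z n Hb Hz). unfold PS_derive_C. ring.
Qed.

Lemma is_derive_Cmod (f : C -> C) (z l : C) :
  (forall eps : posreal, exists del : posreal, forall y,
     Cmod (y - z) < del -> Cmod (f y - f z - (y - z) * l) <= eps * Cmod (y - z)) ->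
  is_derive (K := C_AbsRing) (V := C_NormedModule) f z l.
Proof.
  intros H. split.
  - apply is_linear_scal_l.
  - intros x Hx. 
    apply (is_filter_lim_locally_unique (K := C_AbsRing)
             (V := AbsRing_NormedModule C_AbsRing)) in Hx. subst x.
    intros eps. destruct (H eps) as [del Hd].
    exists del. intros y Hy. exact (Hd y Hy).
Qed.

Lemma in_disk_open (z : C) :
  in_disk z -> exists del : posreal, forall y, Cmod (y - z) < del -> Cmod y <= (1 + Cmod z) / 2.
Proof.
  intros Hz. unfold in_disk in Hz.
  assert (Hp : 0 < (1 - Cmod z) / 2) by lra.
  exists (mkposreal _ Hp). simpl. intros y Hy.
  replace y with (z + (y - z))%C by ring.
  eapply Rle_trans; [apply Cmod_triangle|]. lra.
Qed.

(** Near [z] the difference quotient is itself a power series bounded by a constant [K], so the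
    function is locally Lipschitz at [z]. *)
Lemma csum_continuous (a : nat -> C) (z : C) :
  coef_bounded a -> in_disk z ->
  forall eps : posreal, exists del : posreal, forall y,
    Cmod (y - z) < del -> Cmod (csum a y - csum a z) < eps.
Proof.
  intros Ha Hz eps.
  pose proof (dq_coef_bounded a z Ha Hz) as Hc.
  destruct (in_disk_open z Hz) as [d1 Hd1].
  set (K := Series (fun k => Cmod (dq_coef a z k) * ((1 + Cmod z) / 2) ^ k)).
  assert (HK : forall y, Cmod (y - z) < d1 -> Cmod (csum (dq_coef a z) y) <= K).
  { intros y Hy. apply csum_bound; [exact Hc|]. split; [now apply Hd1|].
    unfold in_disk in Hz. lra. }
  assert (HK0 : 0 <= K).
  { eapply Rle_trans; [|apply (HK z)]; [apply Cmod_ge_0|].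
    replace (z - z)%C with (RtoC 0) by ring. rewrite Cmod_0. apply cond_pos. }
  assert (Hp : 0 < Rmin d1 (eps / (K + 1))).
  { apply Rmin_glb_lt; [apply cond_pos|].
    apply Rdiv_lt_0_compat; [apply cond_pos | lra]. }
  exists (mkposreal _ Hp). simpl. intros y Hy.
  assert (Hy1 : Cmod (y - z) < d1) by (eapply Rlt_le_trans; [exact Hy | apply Rmin_l]).
  assert (Hy2 : Cmod (y - z) < eps / (K + 1))
    by (eapply Rlt_le_trans; [exact Hy | apply Rmin_r]).
  assert (Hyd : in_disk y).
  { unfold in_disk in *. specialize (Hd1 y Hy1). lra. }
  rewrite (csum_dq a z y Ha Hz Hyd).
  replace (csum a z + (y - z) * csum (dq_coef a z) y - csum a z)%C
    with ((y - z) * csum (dq_coef a z) y)%C by ring.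
  rewrite Cmod_mult.
  apply (Rlt_div_r _ _ (K + 1)) in Hy2; [|lra].
  specialize (HK y Hy1). pose proof (Cmod_ge_0 (y - z)).
  nra.
Qed.

(** With [g] the difference quotient at [z], the error of the linear approximation is
    [(y - z) (g y - g z)], so continuity of [g] is enough; [csum_dq_diag] identifies [g z]. *)
Lemma csum_is_derive (a : nat -> C) (z : C) :
  coef_bounded a -> in_disk z ->
  is_derive (K := C_AbsRing) (V := C_NormedModule) (csum a) z (csum (PS_derive_C a) z).
Proof.
  intros Ha Hz. apply is_derive_Cmod. intros eps.
  rewrite <- csum_dq_diag by assumption.
  pose proof (dq_coef_bounded a z Ha Hz) as Hc.
  destruct (csum_continuous _ z Hc Hz eps) as [d1 Hd1].
  destruct (in_disk_open z Hz) as [d2 Hd2].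
  assert (Hp : 0 < Rmin d1 d2) by (apply Rmin_glb_lt; apply cond_pos).
  exists (mkposreal _ Hp). simpl. intros y Hy.
  assert (Hy1 : Cmod (y - z) < d1) by (eapply Rlt_le_trans; [exact Hy | apply Rmin_l]).
  assert (Hy2 : Cmod (y - z) < d2) by (eapply Rlt_le_trans; [exact Hy | apply Rmin_r]).
  assert (Hyd : in_disk y).
  { unfold in_disk in *. specialize (Hd2 y Hy2). lra. }
  rewrite (csum_dq a z y Ha Hz Hyd).
  match goal with |- Cmod ?w <= _ => replace w with
    ((y - z) * (csum (dq_coef a z) y - csum (dq_coef a z) z))%C by ring end.
  rewrite Cmod_mult, Rmult_comm.
  apply Rmult_le_compat_r; [apply Cmod_ge_0|].
  left. now apply Hd1.
Qed.

(** * Complex derivatives *)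

Notation is_Cderive := (is_derive (K := C_AbsRing) (V := C_NormedModule)).
Notation ex_Cderive := (ex_derive (K := C_AbsRing) (V := C_NormedModule)).

Lemma is_Cderive_eq (f : C -> C) (z l l' : C) :
  is_Cderive f z l -> l = l' -> is_Cderive f z l'.
Proof. intros H <-. exact H. Qed.

(* The product and composition rules of Coquelicot are stated for [C] as a module over
   itself, whose uniform structure is not convertible to that of [C_NormedModule]. *)
Lemma is_Cderive_AbsRing (f : C -> C) (z l : C) :
  is_derive (K := C_AbsRing) (V := AbsRing_NormedModule C_AbsRing) f z l <->
  is_Cderive f z l.
Proof.
  split; intros [Hl H].
  - apply is_derive_Cmod. intros eps.
    destruct (H z (fun P HP => HP) eps) as [d Hd].
    exists d. intros y Hy. exact (Hd y Hy).
  - split; [apply is_linear_scal_l|].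
    intros x Hx eps. destruct (H x Hx eps) as [d Hd].
    exists d. intros y Hy. exact (Hd y Hy).
Qed.

Lemma is_Cderive_const (a z : C) : is_Cderive (fun _ => a) z (RtoC 0).
Proof. exact (is_derive_const (K := C_AbsRing) (V := C_NormedModule) a z). Qed.

Lemma is_Cderive_id (z : C) : is_Cderive (fun y => y) z (RtoC 1).
Proof. apply is_Cderive_AbsRing. exact (is_derive_id (K := C_AbsRing) z). Qed.

Lemma is_Cderive_plus (f g : C -> C) (z l m : C) :
  is_Cderive f z l -> is_Cderive g z m -> is_Cderive (fun y => f y + g y)%C z (l + m)%C.
Proof. exact (is_derive_plus (K := C_AbsRing) (V := C_NormedModule) f g z l m). Qed.

Lemma is_Cderive_minus (f g : C -> C) (z l m : C) :
  is_Cderive f z l -> is_Cderive g z m -> is_Cderive (fun y => f y - g y)%C z (l - m)%C.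
Proof. exact (is_derive_minus (K := C_AbsRing) (V := C_NormedModule) f g z l m). Qed.

Lemma is_Cderive_mult (f g : C -> C) (z l m : C) :
  is_Cderive f z l -> is_Cderive g z m ->
  is_Cderive (fun y => f y * g y)%C z (l * g z + f z * m)%C.
Proof.
  intros Hf Hg. apply is_Cderive_AbsRing in Hf. apply is_Cderive_AbsRing in Hg.
  apply is_Cderive_AbsRing.
  exact (is_derive_mult (K := C_AbsRing) f g z l m Hf Hg Cmult_comm).
Qed.

Lemma is_Cderive_comp (f g : C -> C) (z l m : C) :
  is_Cderive f (g z) l -> is_Cderive g z m ->
  is_Cderive (fun y => f (g y)) z (m * l)%C.
Proof.
  intros Hf Hg. apply is_Cderive_AbsRing in Hg.
  exact (is_derive_comp (K := C_AbsRing) (V := C_NormedModule) f g z l m Hf Hg).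
Qed.

Lemma is_Cderive_inv_id (z : C) :
  z <> 0%C -> is_Cderive (fun y => / y)%C z (- / (z * z))%C.
Proof.
  intros Hz. apply is_derive_Cmod. intros eps.
  assert (Hz0 : 0 < Cmod z) by now apply Cmod_gt_0.
  (* This bounds [1 / |z ^ 2 y|], since the radius below forces [|y| > |z| / 2]. *)
  set (K := 2 / (Cmod z * Cmod z * Cmod z)).
  assert (HK : 0 < K).
  { apply Rdiv_lt_0_compat; [lra|]. repeat apply Rmult_lt_0_compat; assumption. }
  assert (Hp : 0 < Rmin (Cmod z / 2) (eps / K)).
  { apply Rmin_glb_lt; [lra|]. apply Rdiv_lt_0_compat; [apply cond_pos | exact HK]. }
  exists (mkposreal _ Hp). simpl. intros y Hy.
  assert (Hy1 : Cmod (y - z) < Cmod z / 2) by (eapply Rlt_le_trans; [exact Hy | apply Rmin_l]).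
  assert (Hy2 : Cmod (y - z) < eps / K) by (eapply Rlt_le_trans; [exact Hy | apply Rmin_r]).
  assert (Hy0 : Cmod z / 2 < Cmod y).
  { assert (Cmod z <= Cmod y + Cmod (y - z)).
    { replace z with (y + - (y - z))%C at 1 by ring.
      eapply Rle_trans; [apply Cmod_triangle|]. rewrite Cmod_opp. lra. }
    lra. }
  assert (Hyn : y <> 0%C) by (apply Cmod_gt_0; lra).
  replace (/ y - / z - (y - z) * - / (z * z))%C
    with ((y - z) * (y - z) / (z * z * y))%C by (field; auto).
  rewrite Cmod_div by (repeat apply Cmult_neq_0; assumption).
  rewrite !Cmod_mult.
  assert (Hd : 0 <= Cmod (y - z)) by apply Cmod_ge_0.
  apply Rle_trans with (Cmod (y - z) * Cmod (y - z) * K).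
  - unfold Rdiv. apply Rmult_le_compat_l; [nra|].
    unfold K. apply Rle_trans with (/ (Cmod z * Cmod z * (Cmod z / 2))).
    + apply Rinv_le_contravar.
      * repeat apply Rmult_lt_0_compat; lra.
      * apply Rmult_le_compat_l; [nra|lra].
    + right. field. lra.
  - apply (Rlt_div_r _ _ K HK) in Hy2.
    nra.
Qed.

Lemma is_Cderive_div (f g : C -> C) (z l m : C) :
  is_Cderive f z l -> is_Cderive g z m -> g z <> 0%C ->
  is_Cderive (fun y => f y / g y)%C z ((l * g z - f z * m) / (g z * g z))%C.
Proof.
  intros Hf Hg Hz.
  pose proof (is_Cderive_comp (fun y => / y)%C g z _ m (is_Cderive_inv_id (g z) Hz) Hg) as Hi.
  eapply is_Cderive_eq; [exact (is_Cderive_mult f (fun y => / g y)%C z _ _ Hf Hi)|].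
  cbv beta. field. exact Hz.
Qed.

Lemma is_Cderive_pow (n : nat) (z : C) :
  is_Cderive (fun y => y ^ n)%C z (RtoC (INR n) * z ^ (n - 1))%C.
Proof.
  induction n as [|n IH].
  - simpl. eapply is_Cderive_eq; [apply is_Cderive_const | ring].
  - eapply is_Cderive_eq;
      [exact (is_Cderive_mult (fun y => y) (fun y => y ^ n)%C z _ _ (is_Cderive_id z) IH)|].
    cbv beta. rewrite S_INR, RtoC_plus.
    destruct n as [|n]; simpl; [ring|]. rewrite Nat.sub_0_r. ring.
Qed.

Lemma is_Cderive_continuous (f : C -> C) (z l : C) :
  is_Cderive f z l ->
  forall eps : posreal, exists del : posreal, forall y,
    Cmod (y - z) < del -> Cmod (f y - f z) < eps.
Proof.
  intros H eps.
  assert (Hc := ex_derive_continuous (K := C_AbsRing) (V := C_NormedModule) f z (ex_intro _ l H)).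
  assert (Hl : locally (T := C_UniformSpace) (f z) (fun w => Cmod (w - f z) < eps)).
  { apply locally_Cmod. now exists eps. }
  destruct (Hc _ Hl) as [d Hd]. exists d. intros y Hy. exact (Hd y Hy).
Qed.

Lemma is_Cderive_ext_disk (f g : C -> C) (z l : C) :
  in_disk z -> (forall y, in_disk y -> f y = g y) -> is_Cderive f z l -> is_Cderive g z l.
Proof.
  intros Hz H. apply is_derive_ext_loc.
  destruct (in_disk_open z Hz) as [d Hd]. exists d. intros y Hy. apply H.
  specialize (Hd y Hy). unfold in_disk in *. lra.
Qed.

(** * The maximum principle *)

Lemma Cmod_minus_ge (y z : C) : Cmod z - Cmod (y - z) <= Cmod y.
Proof.
  assert (Cmod z <= Cmod y + Cmod (y - z)).
  { replace z with (y + - (y - z))%C at 1 by ring.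
    eapply Rle_trans; [apply Cmod_triangle|]. rewrite Cmod_opp. lra. }
  lra.
Qed.

Lemma Cmod_coord_lt (y z : C) (e : R) :
  0 < e -> Rabs (fst y - fst z) < e / 2 -> Rabs (snd y - snd z) < e / 2 ->
  Cmod (y - z) < e.
Proof.
  intros He H1 H2.
  eapply Rle_lt_trans; [apply Cmod_2Rmax|].
  apply Rlt_le_trans with (sqrt 2 * (e / 2)).
  - apply Rmult_lt_compat_l; [apply sqrt_lt_R0; lra|].
    apply Rmax_lub_lt; simpl; assumption.
  - assert (sqrt 2 <= 2).
    { rewrite <- (sqrt_square 2) at 2 by lra. apply sqrt_le_1; lra. }
    nra.
Qed.

(** Compactness in gauge form. A single number [del] serves as neighbourhood size and as gap,
    because what compactness bounds from below is the gauge. The cover is delivered under a double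
    negation, hence the argument by contradiction. *)
Lemma closed_disk_gap (u : C -> R) (S rho : R) :
  (forall z, Cmod z <= rho -> exists del : posreal, forall y,
     Cmod y <= rho -> Cmod (y - z) < del -> u y <= S - del) ->
  exists d : posreal, forall y, Cmod y <= rho -> u y <= S - d.
Proof.
  intros H.
  assert (Hloc : forall i j : R, exists del : posreal, forall y,
    Cmod y <= rho -> Rabs (fst y - i) < del -> Rabs (snd y - j) < del -> u y <= S - del).
  { intros i j. destruct (Rle_lt_dec (Cmod (i, j)) rho) as [Hle|Hlt].
    - destruct (H _ Hle) as [e He].
      assert (Hp : 0 < e / 2) by (generalize (cond_pos e); lra).
      exists (mkposreal _ Hp). simpl. intros y Hy H1 H2.
      assert (u y <= S - e).
      { apply He; [exact Hy|]. apply Cmod_coord_lt; [apply cond_pos | exact H1 | exact H2]. }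
      lra.
    (* The square also has centres outside the disk; there the neighbourhood is taken small enough
       to miss the disk. *)
    - assert (Hp : 0 < (Cmod (i, j) - rho) / 2) by lra.
      exists (mkposreal _ Hp). simpl. intros y Hy H1 H2. exfalso.
      assert (Cmod (y - (i, j)) < Cmod (i, j) - rho)
        by (apply Cmod_coord_lt; [lra | exact H1 | exact H2]).
      generalize (Cmod_minus_ge y (i, j)). lra. }
  pose (del := fun i j => proj1_sig (constructive_indefinite_description _ (Hloc i j))).
  assert (Hdel : forall i j y, Cmod y <= rho -> Rabs (fst y - i) < del i j ->
    Rabs (snd y - j) < del i j -> u y <= S - del i j).
  { intros i j. exact (proj2_sig (constructive_indefinite_description _ (Hloc i j))). }
  destruct (compactness_value_2d (- rho) rho (- rho) rho del) as [d Hd].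
  exists d. intros y Hy. apply Rnot_lt_le. intros Hlt.
  pose proof (Rmax_Cmod y) as Hm.
  pose proof (Rmax_l (Rabs (fst y)) (Rabs (snd y))) as Hm1.
  pose proof (Rmax_r (Rabs (fst y)) (Rabs (snd y))) as Hm2.
  apply (Hd (fst y) (snd y)).
  - apply Rabs_le_between. lra.
  - apply Rabs_le_between. lra.
  - intros (i & j & _ & _ & H1 & H2 & H3).
    generalize (Hdel i j y Hy H1 H2). lra.
Qed.

(** The discrete Laplacian is [o(t ^ 2)]: a weak form of harmonicity that makes sense directly for
    complex values. *)
Definition four_point_mean_property (h : C -> C) (z : C) : Prop :=
  forall eps : posreal, exists del : posreal, forall t, 0 < t < del ->
    Cmod (h (z + RtoC t) + h (z - RtoC t) + h (z + Ci * RtoC t) + h (z - Ci * RtoC t)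
          - 4 * h z)%C <= eps * t ^ 2.

(* Adding [eps |z|^2] to [|h|] makes it strictly subharmonic for four-point means,
   so that it has no interior maximum. *)
Lemma max_principle (h : C -> C) (rho M : R) :
  0 < rho ->
  (exists K, forall z, Cmod z <= rho -> Cmod (h z) <= K) ->
  (forall z, Cmod z <= rho -> forall eps : posreal, exists del : posreal, forall y,
     Cmod (y - z) < del -> Cmod (h y - h z) < eps) ->
  (forall z, Cmod z < rho -> four_point_mean_property h z) ->
  (forall z, Cmod z = rho -> Cmod (h z) <= M) ->
  forall z, Cmod z <= rho -> Cmod (h z) <= M.
Proof.
  intros Hrho [K HK] Hcont Hlap Hbd z Hz.
  apply le_epsilon. intros e0 He0.
  assert (Hr2 : 0 < rho ^ 2) by nra.
  set (eps := e0 / rho ^ 2).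
  assert (Heps : 0 < eps) by (unfold eps; now apply Rdiv_lt_0_compat).
  replace e0 with (eps * rho ^ 2) by (unfold eps; field; lra).
  set (v := fun z => Cmod (h z) + eps * Cmod z ^ 2).
  assert (Hsq : forall y, Cmod y <= rho -> Cmod y ^ 2 <= rho ^ 2).
  { intros y Hy. apply pow_incr. split; [apply Cmod_ge_0 | exact Hy]. }
  destruct (completeness (fun r => exists y, Cmod y <= rho /\ r = v y)) as [S [HS1 HS2]].
  { exists (K + eps * rho ^ 2). intros r (y & Hy & ->). unfold v.
    specialize (HK y Hy). specialize (Hsq y Hy). nra. }
  { exists (v z), z. auto. }
  assert (HvS : forall y, Cmod y <= rho -> v y <= S).
  { intros y Hy. apply HS1. now exists y. }
  (* If the supremum [S] were not attained, every point would have a local gap below [S], and the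
     uniform gap would contradict the choice of [S]. *)
  assert (Hatt : exists z0, Cmod z0 <= rho /\ v z0 = S).
  { apply NNPP. intros Hn.
    destruct (closed_disk_gap v S rho) as [d Hd].
    - intros y Hy.
      assert (Hlt : v y < S).
      { destruct (HvS y Hy) as [Hl|He]; [exact Hl|]. exfalso. apply Hn. now exists y. }
      (* One third of the gap pays for the variation of [|h|], one for that of [eps |z| ^ 2], and
         one remains as the new gap. *)
      set (G := S - v y).
      assert (HG : 0 < G / 3) by (unfold G; lra).
      destruct (Hcont y Hy (mkposreal _ HG)) as [d1 Hd1]. simpl in Hd1.
      assert (Hb : 0 < G / 3 / (2 * rho * eps)).
      { apply Rdiv_lt_0_compat; [exact HG | nra]. }
      assert (Hp : 0 < Rmin d1 (Rmin (G / 3) (G / 3 / (2 * rho * eps)))).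
      { repeat apply Rmin_glb_lt; try assumption. apply cond_pos. }
      exists (mkposreal _ Hp). simpl. intros w Hw Hwy.
      assert (H1 : Cmod (w - y) < d1) by (eapply Rlt_le_trans; [exact Hwy | apply Rmin_l]).
      assert (H2 : Cmod (w - y) < G / 3 / (2 * rho * eps)).
      { eapply Rlt_le_trans; [exact Hwy|]. eapply Rle_trans; apply Rmin_r. }
      assert (H3 : Rmin d1 (Rmin (G / 3) (G / 3 / (2 * rho * eps))) <= G / 3).
      { eapply Rle_trans; [apply Rmin_r | apply Rmin_l]. }
      specialize (Hd1 w H1).
      assert (H4 : Cmod (w - y) * (2 * rho * eps) < G / 3).
      { apply (Rmult_lt_compat_r (2 * rho * eps)) in H2; [|nra].
        replace (G / 3 / (2 * rho * eps) * (2 * rho * eps)) with (G / 3) in H2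
          by (field; split; lra).
        exact H2. }
      assert (H5 : Cmod (h w) <= Cmod (h y) + Cmod (h w - h y)).
      { replace (h w) with (h y + (h w - h y))%C at 1 by ring. apply Cmod_triangle. }
      assert (H6 : Cmod w <= Cmod y + Cmod (w - y)).
      { replace w with (y + (w - y))%C at 1 by ring. apply Cmod_triangle. }
      assert (H7 : Cmod w ^ 2 - Cmod y ^ 2 <= Cmod (w - y) * (2 * rho)).
      { pose proof (Cmod_ge_0 w). pose proof (Cmod_ge_0 y). pose proof (Cmod_ge_0 (w - y)).
        replace (Cmod w ^ 2 - Cmod y ^ 2) with ((Cmod w - Cmod y) * (Cmod w + Cmod y)) by ring.
        apply Rle_trans with (Cmod (w - y) * (Cmod w + Cmod y)).
        - apply Rmult_le_compat_r; lra.
        - apply Rmult_le_compat_l; lra. }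
      assert (H8 : eps * (Cmod w ^ 2 - Cmod y ^ 2) <= Cmod (w - y) * (2 * rho * eps)).
      { replace (Cmod (w - y) * (2 * rho * eps)) with (eps * (Cmod (w - y) * (2 * rho))) by ring.
        apply Rmult_le_compat_l; lra. }
      unfold G, v in *. lra.
    - assert (S <= S - d).
      { apply HS2. intros r (y & Hy & ->). now apply Hd. }
      generalize (cond_pos d). lra. }
  destruct Hatt as (z0 & Hz0 & HS).
  assert (HSb : S <= M + eps * rho ^ 2).
  { destruct Hz0 as [Hlt|Heq].
    - exfalso.
      destruct (Hlap z0 Hlt (mkposreal _ Heps)) as [d Hd]. simpl in Hd.
      set (t := Rmin d (rho - Cmod z0) / 2).
      assert (Hm : 0 < Rmin d (rho - Cmod z0)) by (apply Rmin_glb_lt; [apply cond_pos | lra]).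
      assert (Ht : 0 < t < d /\ t < rho - Cmod z0).
      { pose proof (Rmin_l d (rho - Cmod z0)). pose proof (Rmin_r d (rho - Cmod z0)).
        unfold t. lra. }
      destruct Ht as [Ht1 Ht2]. specialize (Hd t Ht1).
      assert (Hct : Cmod (RtoC t) = t) by (rewrite Cmod_R; apply Rabs_pos_eq; lra).
      assert (Hcit : Cmod (Ci * RtoC t) = t) by (rewrite Cmod_mult, Cmod_Ci, Hct; ring).
      assert (Hin : forall w, Cmod w = t -> Cmod (z0 + w) <= rho).
      { intros w Hw. eapply Rle_trans; [apply Cmod_triangle|]. lra. }
      pose proof (HvS (z0 + RtoC t)%C (Hin _ Hct)) as V1.
      pose proof (HvS (z0 - RtoC t)%C (Hin (- RtoC t)%C ltac:(now rewrite Cmod_opp))) as V2.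
      pose proof (HvS (z0 + Ci * RtoC t)%C (Hin _ Hcit)) as V3.
      pose proof (HvS (z0 - Ci * RtoC t)%C (Hin (- (Ci * RtoC t))%C ltac:(now rewrite Cmod_opp))) as V4.
      unfold v in V1, V2, V3, V4, HS.
      set (p1 := (z0 + RtoC t)%C) in *. set (p2 := (z0 - RtoC t)%C) in *.
      set (p3 := (z0 + Ci * RtoC t)%C) in *. set (p4 := (z0 - Ci * RtoC t)%C) in *.
      (* The quadratic term gains [4 eps t ^ 2] over the four points while the mean property of [h]
         loses at most [eps t ^ 2], so some [v pi] exceeds [S]. *)
      assert (Hsum : Cmod p1 ^ 2 + Cmod p2 ^ 2 + Cmod p3 ^ 2 + Cmod p4 ^ 2
                     = 4 * Cmod z0 ^ 2 + 4 * t ^ 2).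
      { unfold p1, p2, p3, p4. rewrite !Cmod2_alt. destruct z0 as [x y].
        unfold Ci, RtoC, Re, Im; simpl. ring. }
      assert (Htri : 4 * Cmod (h z0) <=
        Cmod (h p1) + Cmod (h p2) + Cmod (h p3) + Cmod (h p4) + eps * t ^ 2).
      { set (w := (h p1 + h p2 + h p3 + h p4 - 4 * h z0)%C) in *.
        replace (4 * Cmod (h z0)) with (Cmod (4 * h z0)%C).
        2:{ rewrite Cmod_mult, Cmod_R, Rabs_pos_eq; lra. }
        replace (4 * h z0)%C with (h p1 + h p2 + h p3 + h p4 + - w)%C by (unfold w; ring).
        eapply Rle_trans; [apply Cmod_triangle|]. rewrite Cmod_opp.
        apply Rplus_le_compat; [|exact Hd].
        repeat (eapply Rle_trans; [apply Cmod_triangle|]; apply Rplus_le_compat_r).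
        apply Rle_refl. }
      assert (0 < eps * t ^ 2) by (apply Rmult_lt_0_compat; [exact Heps | nra]).
      nra.
    - rewrite <- HS. unfold v. rewrite Heq. specialize (Hbd z0 Heq). lra. }
  specialize (HvS z Hz). unfold v in HvS.
  assert (0 <= eps * Cmod z ^ 2) by (apply Rmult_le_pos; [lra | apply pow2_ge_0]).
  lra.
Qed.

(** * Schwarz's lemma for the class P *)

(** Apply the gap lemma to [- 1 / (1 + |h|)], which is locally bounded away from 0: a uniform gap
    [d] means [1 + |h| <= 1 / d]. *)
Lemma closed_disk_bounded (h : C -> C) (rho : R) :
  (forall z, Cmod z <= rho -> forall eps : posreal, exists del : posreal, forall y,
     Cmod (y - z) < del -> Cmod (h y - h z) < eps) ->
  exists K, forall z, Cmod z <= rho -> Cmod (h z) <= K.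
Proof.
  intros Hcont.
  destruct (closed_disk_gap (fun y => - / (1 + Cmod (h y))) 0 rho) as [d Hd].
  - intros z Hz. destruct (Hcont z Hz (mkposreal 1 Rlt_0_1)) as [d1 Hd1]. simpl in Hd1.
    assert (Hz0 := Cmod_ge_0 (h z)).
    assert (Hq : 0 < / (2 + Cmod (h z))) by (apply Rinv_0_lt_compat; lra).
    assert (Hp : 0 < Rmin d1 (/ (2 + Cmod (h z)))).
    { apply Rmin_glb_lt; [apply cond_pos | exact Hq]. }
    exists (mkposreal _ Hp). simpl. intros y _ Hy.
    specialize (Hd1 y (Rlt_le_trans _ _ _ Hy (Rmin_l _ _))).
    assert (H5 : Cmod (h y) <= Cmod (h z) + Cmod (h y - h z)).
    { replace (h y) with (h z + (h y - h z))%C at 1 by ring. apply Cmod_triangle. }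
    assert (H6 := Cmod_ge_0 (h y)).
    assert (/ (2 + Cmod (h z)) <= / (1 + Cmod (h y))) by (apply Rinv_le_contravar; lra).
    assert (H7 := Rmin_r d1 (/ (2 + Cmod (h z)))). lra.
  - exists (/ d). intros z Hz. specialize (Hd z Hz). simpl in Hd.
    assert (H6 := Cmod_ge_0 (h z)).
    assert (Hd0 := cond_pos d).
    apply Rle_trans with (1 + Cmod (h z)); [lra|].
    rewrite <- (Rinv_inv (1 + Cmod (h z))).
    apply Rinv_le_contravar; lra.
Qed.

(** * Second-order expansions and four-point means *)

(** A Taylor expansion of order two at [z] whose remainder factor [g] is differentiable at [z].
    Differentiability of [g], rather than mere continuity, lets [f] itself be differentiated, and
    the notion is stable under quotients. *)
Definition jet2 (f : C -> C) (z : C) : Prop :=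
  exists (f1 : C) (g : C -> C),
    (forall y, in_disk y -> f y = f z + (y - z) * (f1 + (y - z) * g y))%C /\
    ex_Cderive g z.

Lemma is_Cderive_shift (z : C) : is_Cderive (fun y => y - z)%C z (RtoC 1).
Proof.
  eapply is_Cderive_eq;
    [exact (is_Cderive_minus (fun y => y) (fun _ => z) z _ _ (is_Cderive_id z)
              (is_Cderive_const z z)) | ring].
Qed.

Lemma jet2_derivable (f : C -> C) (z : C) : in_disk z -> jet2 f z -> ex_Cderive f z.
Proof.
  intros Hz (f1 & g & Hf & l & Hg).
  eexists. apply (is_Cderive_ext_disk (fun y => f z + (y - z) * (f1 + (y - z) * g y))%C);
    [exact Hz | now intros y Hy; symmetry; apply Hf |].
  apply (is_Cderive_plus (fun _ => f z)); [apply is_Cderive_const|].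
  apply (is_Cderive_mult (fun y => y - z)%C); [apply is_Cderive_shift|].
  apply (is_Cderive_plus (fun _ => f1)); [apply is_Cderive_const|].
  apply (is_Cderive_mult (fun y => y - z)%C); [apply is_Cderive_shift|].
  exact Hg.
Qed.

Lemma jet2_csum (a : nat -> C) (z : C) :
  coef_bounded a -> in_disk z -> jet2 (csum a) z.
Proof.
  intros Ha Hz.
  pose proof (dq_coef_bounded a z Ha Hz) as Ha1.
  pose proof (dq_coef_bounded _ z Ha1 Hz) as Ha2.
  exists (csum (dq_coef a z) z), (csum (dq_coef (dq_coef a z) z)). split.
  - intros y Hy. rewrite (csum_dq a z y Ha Hz Hy) at 1.
    now rewrite (csum_dq (dq_coef a z) z y Ha1 Hz Hy) at 1.
  - eexists. now apply csum_is_derive.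
Qed.

Lemma jet2_affine (f : C -> C) (z a b : C) :
  jet2 f z -> jet2 (fun y => a + b * f y)%C z.
Proof.
  intros (f1 & g & Hf & l & Hg).
  exists (b * f1)%C, (fun y => b * g y)%C. split.
  - intros y Hy. rewrite (Hf y Hy). ring.
  - eexists. exact (is_Cderive_mult (fun _ => b) g z _ _ (is_Cderive_const b z) Hg).
Qed.

Lemma jet2_div (f k : C -> C) (z : C) :
  in_disk z -> (forall y, in_disk y -> k y <> 0%C) ->
  jet2 f z -> jet2 k z -> jet2 (fun y => f y / k y)%C z.
Proof.
  intros Hz Hk0 Jf Jk.
  destruct (jet2_derivable k z Hz Jk) as [dk Hdk].
  destruct Jf as (f1 & f2 & Hf & lf & Hf2). destruct Jk as (k1 & k2 & Hk & lk & Hk2).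
  (* The coefficients come from solving [f = k (lam + (y - z) h1 + (y - z) ^ 2 h2)] order by
     order. *)
  set (lam := (f z / k z)%C). set (h1 := ((f1 - lam * k1) / k z)%C).
  exists h1, (fun y => (f2 y - lam * k2 y - h1 * (k1 + (y - z) * k2 y)) / k y)%C. split.
  - intros y Hy.
    pose proof (Hk0 z Hz) as Hkz. pose proof (Hk0 y Hy) as Hky.
    match goal with |- _ = (?A + ?w * (?B + ?w' * (?N / k y)))%C =>
      replace (A + w * (B + w' * (N / k y)))%C
      with ((A * k y + w * (B * k y + w' * N)) / k y)%C by (field; auto) end.
    f_equal.
    rewrite (Hf y Hy), (Hk y Hy). unfold h1, lam. field. exact Hkz.
  - eexists. apply is_Cderive_div; [|exact Hdk | now apply Hk0].
    apply (is_Cderive_minus (fun y => f2 y - lam * k2 y)%C).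
    + apply (is_Cderive_minus f2); [exact Hf2|].
      apply (is_Cderive_mult (fun _ => lam)); [apply is_Cderive_const | exact Hk2].
    + apply (is_Cderive_mult (fun _ => h1)); [apply is_Cderive_const|].
      apply (is_Cderive_plus (fun _ => k1)); [apply is_Cderive_const|].
      apply (is_Cderive_mult (fun y => y - z)%C); [apply is_Cderive_shift | exact Hk2].
Qed.

(** The increments [t], [-t], [i t], [-i t] have sum 0 and their squares have sum 0, so the terms in
    [f1] and [g z] cancel. What remains is [t ^ 2] times four variations of [g], each below
    [eps / 4]. *)
Lemma jet2_four_point (f : C -> C) (z : C) :
  in_disk z -> jet2 f z -> four_point_mean_property f z.
Proof.
  intros Hz (f1 & g & Hf & l & Hg) eps.
  assert (He : 0 < eps / 4) by (generalize (cond_pos eps); lra).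
  destruct (is_Cderive_continuous g z l Hg (mkposreal _ He)) as [d1 Hd1]. simpl in Hd1.
  destruct (in_disk_open z Hz) as [d2 Hd2].
  assert (Hp : 0 < Rmin d1 d2) by (apply Rmin_glb_lt; apply cond_pos).
  exists (mkposreal _ Hp). simpl. intros t Ht.
  assert (Ht1 : t < d1) by (eapply Rlt_le_trans; [apply Ht | apply Rmin_l]).
  assert (Ht2 : t < d2) by (eapply Rlt_le_trans; [apply Ht | apply Rmin_r]).
  assert (Hexp : forall w, Cmod w = t ->
    f (z + w)%C = (f z + w * (f1 + w * g (z + w)%C))%C /\
    Cmod (g (z + w)%C - g z) < eps / 4).
  { intros w Hw.
    replace w with (z + w - z)%C in Hw by ring. split.
    - rewrite Hf at 1.
      + now replace (z + w - z)%C with w by ring.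
      + specialize (Hd2 (z + w)%C ltac:(lra)). unfold in_disk in *. lra.
    - apply Hd1. lra. }
  assert (Hct : Cmod (RtoC t) = t) by (rewrite Cmod_R; apply Rabs_pos_eq; lra).
  assert (Hcit : Cmod (Ci * RtoC t) = t) by (rewrite Cmod_mult, Cmod_Ci, Hct; ring).
  destruct (Hexp _ Hct) as [E1 B1].
  destruct (Hexp (- RtoC t)%C ltac:(now rewrite Cmod_opp)) as [E2 B2].
  destruct (Hexp _ Hcit) as [E3 B3].
  destruct (Hexp (- (Ci * RtoC t))%C ltac:(now rewrite Cmod_opp)) as [E4 B4].
  change (z - RtoC t)%C with (z + - RtoC t)%C.
  change (z - Ci * RtoC t)%C with (z + - (Ci * RtoC t))%C.
  rewrite E1, E2, E3, E4.
  set (g1 := g (z + RtoC t)%C) in *. set (g2 := g (z + - RtoC t)%C) in *.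
  set (g3 := g (z + Ci * RtoC t)%C) in *. set (g4 := g (z + - (Ci * RtoC t))%C) in *.
  assert (Hi : (Ci * Ci = - 1)%C) by (unfold Ci, Cmult, Copp, RtoC; simpl; f_equal; ring).
  match goal with |- Cmod ?w <= _ => replace w with
    (RtoC t * RtoC t * ((g1 - g z) + (g2 - g z) + - (g3 - g z) + - (g4 - g z)))%C end.
  - rewrite !Cmod_mult, Hct.
    apply Rle_trans with (t * t * (eps / 4 + eps / 4 + eps / 4 + eps / 4)); [|right; field].
    apply Rmult_le_compat_l; [nra|].
    left. eapply Rle_lt_trans; [apply Cmod_triangle|].
    apply Rplus_lt_compat; [|now rewrite Cmod_opp].
    eapply Rle_lt_trans; [apply Cmod_triangle|].
    apply Rplus_lt_compat; [|now rewrite Cmod_opp].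
    eapply Rle_lt_trans; [apply Cmod_triangle|].
    apply Rplus_lt_compat; assumption.
  - transitivity (RtoC t * RtoC t * (g1 + g2) + Ci * Ci * (RtoC t * RtoC t) * (g3 + g4))%C;
      [rewrite Hi|]; ring.
Qed.

Lemma csum_zeros (a : nat -> C) (z : C) (m : nat) :
  coef_bounded a -> in_disk z -> (forall k, (k < m)%nat -> a k = 0%C) ->
  csum a z = (z ^ m * csum (fun k => a (m + k)%nat) z)%C.
Proof.
  revert a. induction m as [|m IH]; intros a Ha Hz H0.
  - simpl. change (fun k => a k) with a. ring.
  - rewrite (csum_step a z Ha Hz), (H0 0%nat ltac:(lia)).
    rewrite (IH (fun k => a (S k))).
    + simpl. ring.
    + exact (coef_bounded_shift a 1 Ha).
    + exact Hz.
    + intros k Hk. apply H0. lia.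
Qed.

(* Schwarz's lemma with a zero of order [n], applied to the function [w] such that
   [p = mobius c d w]: the maximum principle is used for [w z / z ^ n]. *)
Lemma class_P_bound (n : nat) (c d : R) (p : C -> C) (z : C) :
  (1 <= n)%nat -> d < c -> -1 <= d <= 1 -> class_P n c d p -> in_disk z ->
  Cmod (p z - 1) * (1 - Rabs d * Cmod z ^ n) <= (c - d) * Cmod z ^ n.
Proof.
  intros Hn Hcd Hd (_ & (b & Hb0 & Hbz & Hb) & (w & _ & Hw0 & Hwz & Hpw)) Hz.
  pose proof (coef_bounded_of_expansion _ _ Hb) as Hbb.
  set (q := csum (fun k => b (n + k)%nat)).
  assert (Hpq : forall y, in_disk y -> p y = (1 + y ^ n * q y)%C).
  { intros y Hy. rewrite (has_expansion_csum p b y Hb Hy).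
    destruct n as [|m]; [lia|].
    rewrite (csum_step b y Hbb Hy), Hb0.
    rewrite (csum_zeros (fun k => b (S k)) y m).
    - simpl. unfold q. simpl. ring.
    - exact (coef_bounded_shift b 1 Hbb).
    - exact Hy.
    - intros k Hk. apply Hbz. lia. }
  (* [B] is [c - d p], kept as a power series. From [p - 1 = w B] and [p - 1 = z ^ n q] the function
     [w / z ^ n] becomes [q / B], defined at the origin too. *)
  set (B := fun y => (RtoC c + - RtoC d * csum b y)%C).
  assert (HB : forall y, in_disk y -> B y = (RtoC c - RtoC d * p y)%C).
  { intros y Hy. unfold B. rewrite (has_expansion_csum p b y Hb Hy). ring. }
  assert (Hden : forall y, in_disk y -> (1 + RtoC d * w y <> 0)%C).
  { intros y Hy H0. specialize (Hwz y Hy). unfold in_disk in Hy.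
    assert (H1 : Cmod (RtoC d * w y) = 1).
    { replace (RtoC d * w y)%C with (1 + RtoC d * w y - 1)%C by ring.
      rewrite H0. replace (0 - 1)%C with (- (1))%C by ring. apply Cmod_m1. }
    rewrite Cmod_mult, Cmod_R in H1.
    assert (Rabs d <= 1) by (apply Rabs_le; lra).
    pose proof (Cmod_ge_0 (w y)). pose proof (Rabs_pos d). nra. }
  assert (HBw : forall y, in_disk y ->
    (B y * (1 + RtoC d * w y) = RtoC (c - d))%C /\ (p y - 1 = w y * B y)%C).
  { intros y Hy. rewrite (HB y Hy), (Hpw y Hy). unfold mobius.
    rewrite RtoC_minus. specialize (Hden y Hy). split; field; exact Hden. }
  assert (HB0 : forall y, in_disk y -> B y <> 0%C).
  { intros y Hy H0. destruct (HBw y Hy) as [H1 _]. rewrite H0 in H1.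
    rewrite Cmult_0_l in H1. apply (RtoC_inj 0) in H1. lra. }
  assert (Hqb : coef_bounded (fun k => b (n + k)%nat)) by now apply coef_bounded_shift.
  set (h := fun y => (q y / B y)%C).
  assert (Hjet : forall y, in_disk y -> jet2 h y).
  { intros y Hy. apply jet2_div; [exact Hy | exact HB0 | now apply jet2_csum|].
    now apply jet2_affine, jet2_csum. }
  (* On the circle [|y| = rho] one has [|h| = |w| / rho ^ n <= 1 / rho ^ n]; the maximum principle
     carries this inside. *)
  assert (Hmax : forall rho, Cmod z <= rho -> 0 < rho < 1 -> rho ^ n * Cmod (q z) <= Cmod (B z)).
  { intros rho Hzr Hrho.
    assert (Hr : 0 < rho ^ n) by (apply pow_lt; lra).
    assert (Hcont : forall y, Cmod y <= rho -> forall eps : posreal, exists del : posreal,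
      forall v, Cmod (v - y) < del -> Cmod (h v - h y) < eps).
    { intros y Hy. assert (Hyd : in_disk y) by (unfold in_disk; lra).
      destruct (jet2_derivable h y Hyd (Hjet y Hyd)) as [l Hl].
      exact (is_Cderive_continuous h y l Hl). }
    assert (HM : Cmod (h z) <= / rho ^ n).
    { apply (max_principle h rho); [lra | now apply closed_disk_bounded | exact Hcont | | | exact Hzr].
      - intros y Hy. assert (Hyd : in_disk y) by (unfold in_disk; lra).
        apply jet2_four_point; auto.
      - intros y Hy. assert (Hyd : in_disk y) by (unfold in_disk; lra).
        destruct (HBw y Hyd) as [_ H1]. rewrite (Hpq y Hyd) in H1.
        specialize (Hwz y Hyd). unfold h.
        assert (Hwq : (y ^ n * (q y / B y) = w y)%C).
        { replace (w y) with (w y * B y / B y)%C by (field; now apply HB0).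
          rewrite <- H1. field. now apply HB0. }
        assert (Hm : rho ^ n * Cmod (q y / B y) <= 1).
        { rewrite <- Hy, <- Cmod_pow, <- Cmod_mult, Hwq. lra. }
        apply (Rmult_le_reg_l (rho ^ n)); [exact Hr|].
        rewrite Rinv_r by lra. exact Hm. }
    unfold h in HM. rewrite Cmod_div in HM by now apply HB0.
    assert (HBp : 0 < Cmod (B z)) by (apply Cmod_gt_0; now apply HB0).
    apply (Rmult_le_compat_r (rho ^ n * Cmod (B z))) in HM; [|nra].
    replace (Cmod (q z) / Cmod (B z) * (rho ^ n * Cmod (B z))) with (rho ^ n * Cmod (q z)) in HM
      by (field; lra).
    replace (/ rho ^ n * (rho ^ n * Cmod (B z))) with (Cmod (B z)) in HM by (field; lra).
    exact HM. }
  assert (HqB : Cmod (q z) <= Cmod (B z)).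
  { unfold in_disk in Hz. pose proof (Cmod_ge_0 z) as Hz0.
    (* Radii tending to 1 from below; all are at least [(1 + |z|) / 2], so each circle encloses
       [z]. *)
    set (u := fun k : nat => 1 - (1 - Cmod z) / 2 / (INR k + 1)).
    assert (Hu : is_lim_seq u 1).
    { replace (Finite 1) with (Finite (1 - (1 - Cmod z) / 2 * 0)) by (f_equal; ring).
      apply is_lim_seq_minus'; [apply is_lim_seq_const|].
      apply (is_lim_seq_scal_l _ ((1 - Cmod z) / 2) 0).
      apply (is_lim_seq_ext (fun k => / INR (S k))); [intros k; now rewrite S_INR|].
      apply -> (is_lim_seq_incr_1 (fun k => / INR k)).
      replace (Finite 0) with (Rbar_inv p_infty) by reflexivity.
      apply is_lim_seq_inv; [apply is_lim_seq_INR | discriminate]. }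
    assert (Hul : is_lim_seq (fun k => u k ^ n * Cmod (q z)) (Cmod (q z))).
    { replace (Finite (Cmod (q z))) with (Rbar_mult (1 ^ n) (Cmod (q z)))
        by (rewrite pow1; simpl; f_equal; ring).
      apply is_lim_seq_scal_r. 
      apply (is_lim_seq_continuous (fun x => x ^ n)); [|exact Hu].
      apply derivable_continuous_pt, derivable_pt_pow. }
    refine (is_lim_seq_le _ (fun _ => Cmod (B z)) (Cmod (q z)) (Cmod (B z)) _ Hul
              (is_lim_seq_const _)).
    intros k.
    assert (Hk := pos_INR k).
    assert (Hv : 0 < (1 - Cmod z) / 2 / (INR k + 1) <= (1 - Cmod z) / 2).
    { split; [apply Rdiv_lt_0_compat; lra|].
      apply (Rle_div_l _ _ (INR k + 1)); [lra|]. nra. }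
    apply Hmax; unfold u; lra. }
  assert (Hx : 0 <= Cmod z ^ n) by (apply pow_le, Cmod_ge_0).
  assert (HP : Cmod (p z - 1) <= Cmod z ^ n * Cmod (B z)).
  { rewrite (Hpq z Hz). replace (1 + z ^ n * q z - 1)%C with (z ^ n * q z)%C by ring.
    rewrite Cmod_mult, Cmod_pow. now apply Rmult_le_compat_l. }
  (* [c - d p = (c - d) - d (p - 1)] bounds [|B|] by [|p - 1|] again; solving the resulting linear
     inequality for [|p - 1|] gives the claim. *)
  assert (HBle : Cmod (B z) <= (c - d) + Rabs d * Cmod (p z - 1)).
  { rewrite (HB z Hz).
    replace (RtoC c - RtoC d * p z)%C with (RtoC (c - d) + - (RtoC d * (p z - 1)))%C
      by (rewrite RtoC_minus; ring).
    eapply Rle_trans; [apply Cmod_triangle|].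
    rewrite Cmod_opp, Cmod_mult, !Cmod_R, (Rabs_pos_eq (c - d)) by lra. lra. }
  assert (Cmod z ^ n * Cmod (B z) <= Cmod z ^ n * ((c - d) + Rabs d * Cmod (p z - 1)))
    by (apply Rmult_le_compat_l; assumption).
  lra.
Qed.

(** * The complex hyperbolic sine *)

Definition Cexp (u : C) : C := (exp (fst u) * cos (snd u), exp (fst u) * sin (snd u)).

Lemma Cexp_plus (u v : C) : Cexp (u + v) = (Cexp u * Cexp v)%C.
Proof.
  unfold Cexp, Cmult; simpl. rewrite exp_plus, cos_plus, sin_plus. f_equal; ring.
Qed.

Lemma Cexp_RtoC (x : R) : Cexp (RtoC x) = RtoC (exp x).
Proof. unfold Cexp, RtoC; simpl. rewrite cos_0, sin_0. f_equal; ring. Qed.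

Lemma Cexp_opp_r (u : C) : (Cexp u * Cexp (- u) = 1)%C.
Proof.
  rewrite <- Cexp_plus. replace (u + - u)%C with (RtoC 0) by ring.
  now rewrite Cexp_RtoC, exp_0.
Qed.

Lemma derivable_pt_lim_0_bound (f : R -> R) (l : R) :
  derivable_pt_lim f 0 l -> forall eps, 0 < eps -> exists del : posreal,
  forall h, Rabs h < del -> Rabs (f h - f 0 - l * h) <= eps * Rabs h.
Proof.
  intros H eps He. destruct (H eps He) as [d Hd]. exists d. intros h Hh.
  destruct (Req_dec h 0) as [->|Hn].
  - rewrite Rabs_R0, Rmult_0_r, Rmult_0_r. unfold Rminus.
    rewrite Ropp_0, Rplus_0_r, Rplus_opp_r, Rabs_R0. lra.
  - specialize (Hd h Hn Hh). rewrite Rplus_0_l in Hd.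
    replace (f h - f 0 - l * h) with (((f h - f 0) / h - l) * h) by (field; exact Hn).
    rewrite Rabs_mult. apply Rmult_le_compat_r; [apply Rabs_pos | lra].
Qed.

Lemma Cexp_o (eps : posreal) : exists del : posreal, forall h : C,
  Cmod h < del -> Cmod (Cexp h - 1 - h) <= eps * Cmod h.
Proof.
  set (e := Rmin (eps / 14) 1).
  assert (He : 0 < e).
  { apply Rmin_glb_lt; [|lra]. generalize (cond_pos eps). lra. }
  assert (He1 : e <= 1) by apply Rmin_r.
  assert (He2 : 14 * e <= eps).
  { generalize (Rmin_l (eps / 14) 1). fold e. lra. }
  destruct (derivable_pt_lim_0_bound exp 1) with (eps := e) as [d1 Hd1]; [|exact He|].
  { rewrite <- exp_0. apply derivable_pt_lim_exp. }
  destruct (derivable_pt_lim_0_bound cos 0) with (eps := e) as [d2 Hd2]; [|exact He|].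
  { replace 0 with (- sin 0) at 2 by (rewrite sin_0; ring). apply derivable_pt_lim_cos. }
  destruct (derivable_pt_lim_0_bound sin 1) with (eps := e) as [d3 Hd3]; [|exact He|].
  { rewrite <- cos_0. apply derivable_pt_lim_sin. }
  (* The entry [e] makes the second-order product [(exp x - 1) * y] at most [2 e |h|]. Each
     coordinate of the error is then at most [5 e |h|], and [5 * sqrt 2 <= 14]. *)
  assert (Hp : 0 < Rmin e (Rmin d1 (Rmin d2 d3))).
  { apply Rmin_glb_lt; [exact He|]. repeat apply Rmin_glb_lt; apply cond_pos. }
  exists (mkposreal _ Hp). simpl. intros [x y] Hh.
  assert (Hm := Rmax_Cmod (x, y)). simpl in Hm.
  assert (Hx : Rabs x <= Cmod (x, y)) by (eapply Rle_trans; [apply Rmax_l | exact Hm]).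
  assert (Hy : Rabs y <= Cmod (x, y)) by (eapply Rle_trans; [apply Rmax_r | exact Hm]).
  set (m := Cmod (x, y)) in *.
  pose proof (Rmin_l e (Rmin d1 (Rmin d2 d3))) as M1.
  pose proof (Rmin_r e (Rmin d1 (Rmin d2 d3))) as M2.
  pose proof (Rmin_l d1 (Rmin d2 d3)) as M3. pose proof (Rmin_r d1 (Rmin d2 d3)) as M4.
  pose proof (Rmin_l d2 d3) as M5. pose proof (Rmin_r d2 d3) as M6.
  specialize (Hd1 x ltac:(lra)). specialize (Hd2 y ltac:(lra)). specialize (Hd3 y ltac:(lra)).
  rewrite exp_0, Rmult_1_l in Hd1. rewrite cos_0, Rmult_0_l in Hd2.
  rewrite sin_0, Rmult_1_l in Hd3.
  pose proof (Rabs_pos x) as Px. pose proof (Rabs_pos y) as Py.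
  assert (A1 : Rabs (exp x - 1) <= 2 * Rabs x).
  { replace (exp x - 1) with ((exp x - 1 - x) + x) by ring.
    eapply Rle_trans; [apply Rabs_triang|]. nra. }
  assert (A2 : Rabs (exp x) <= 3).
  { replace (exp x) with ((exp x - 1) + 1) by ring.
    eapply Rle_trans; [apply Rabs_triang|]. rewrite Rabs_R1. lra. }
  eapply Rle_trans; [apply Cmod_2Rmax|].
  assert (Hs2 : sqrt 2 <= 2).
  { rewrite <- (sqrt_square 2) at 2 by lra. apply sqrt_le_1; lra. }
  assert (Hs0 := sqrt_pos 2).
  assert (HR : Rmax (Rabs (fst (Cexp (x, y) - 1 - (x, y))%C))
                    (Rabs (snd (Cexp (x, y) - 1 - (x, y))%C)) <= 5 * e * m).
  { apply Rmax_lub; simpl.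
    - replace (exp x * cos y + - (1) + - x)
        with (exp x * (cos y - 1 - 0) + (exp x - 1 - x)) by ring.
      eapply Rle_trans; [apply Rabs_triang|]. rewrite Rabs_mult.
      pose proof (Rabs_pos (cos y - 1 - 0)). nra.
    - replace (exp x * sin y + - 0 + - y)
        with (exp x * (sin y - 0 - y) + (exp x - 1) * y) by ring.
      eapply Rle_trans; [apply Rabs_triang|]. rewrite !Rabs_mult.
      pose proof (Rabs_pos (sin y - 0 - y)). pose proof (Rabs_pos (exp x - 1)).
      assert (Rabs (exp x) * Rabs (sin y - 0 - y) <= 3 * (e * m)) by nra.
      assert (Rabs (exp x - 1) * Rabs y <= 2 * e * m) by nra.
      lra. }
  assert (0 <= e * m) by nra.
  pose proof (Rabs_pos (fst (Cexp (x, y) - 1 - (x, y))%C)).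
  nra.
Qed.

Lemma is_Cderive_Cexp (z : C) : is_Cderive Cexp z (Cexp z).
Proof.
  apply is_derive_Cmod. intros eps.
  assert (HK : 0 < Cmod (Cexp z) + 1) by (generalize (Cmod_ge_0 (Cexp z)); lra).
  assert (He : 0 < eps / (Cmod (Cexp z) + 1)) by (apply Rdiv_lt_0_compat; [apply cond_pos | lra]).
  destruct (Cexp_o (mkposreal _ He)) as [d Hd]. simpl in Hd.
  exists d. intros y Hy. specialize (Hd _ Hy).
  replace (Cexp y) with (Cexp z * Cexp (y - z))%C.
  2:{ rewrite <- Cexp_plus. f_equal. ring. }
  replace (Cexp z * Cexp (y - z) - Cexp z - (y - z) * Cexp z)%C
    with (Cexp z * (Cexp (y - z) - 1 - (y - z)))%C by ring.
  rewrite Cmod_mult.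
  apply Rle_trans with ((Cmod (Cexp z) + 1) * (eps / (Cmod (Cexp z) + 1) * Cmod (y - z))).
  - apply Rmult_le_compat; try apply Cmod_ge_0; [lra | exact Hd].
  - right. field. lra.
Qed.

Definition Csinh (u : C) : C := ((Cexp u - Cexp (- u)) / 2)%C.
Definition Ccosh (u : C) : C := ((Cexp u + Cexp (- u)) / 2)%C.

Lemma C2_neq_0 : RtoC 2 <> RtoC 0.
Proof. intros H. apply RtoC_inj in H. lra. Qed.

Lemma is_Cderive_Csinh (z : C) : is_Cderive Csinh z (Ccosh z).
Proof.
  assert (Hopp : is_Cderive (fun y => - y)%C z (- (1))%C).
  { exact (is_derive_opp (K := C_AbsRing) (V := C_NormedModule) (fun y : C => y) z _
             (is_Cderive_id z)). }
  eapply is_Cderive_eq.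
  - apply (is_Cderive_div (fun u => Cexp u - Cexp (- u))%C (fun _ => RtoC 2));
      [|apply is_Cderive_const | exact C2_neq_0].
    apply (is_Cderive_minus Cexp); [apply is_Cderive_Cexp|].
    apply (is_Cderive_comp Cexp (fun y => - y)%C); [apply is_Cderive_Cexp | exact Hopp].
  - unfold Ccosh. field.
Qed.

Lemma Csinh_coord (u : C) :
  Csinh u = (sinh (fst u) * cos (snd u), cosh (fst u) * sin (snd u)).
Proof.
  unfold Csinh, Cexp, sinh, cosh. apply injective_projections; simpl;
  rewrite cos_neg, sin_neg; field.
Qed.

Lemma Ccosh_coord (u : C) :
  Ccosh u = (cosh (fst u) * cos (snd u), sinh (fst u) * sin (snd u)).
Proof.
  unfold Ccosh, Cexp, sinh, cosh. apply injective_projections; simpl;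
  rewrite cos_neg, sin_neg; field.
Qed.

Lemma Csinh_0 : Csinh 0 = 0%C.
Proof. rewrite Csinh_coord. simpl. rewrite sinh_0, sin_0. unfold RtoC. f_equal; ring. Qed.

Lemma cosh_pos (x : R) : 0 < cosh x.
Proof. unfold cosh. generalize (exp_pos x) (exp_pos (- x)). lra. Qed.

Lemma cosh2_sinh2 (x : R) : cosh x ^ 2 - sinh x ^ 2 = 1.
Proof.
  unfold cosh, sinh.
  assert (H : exp x * exp (- x) = 1) by (rewrite <- exp_plus, Rplus_opp_r; apply exp_0).
  nra.
Qed.

Lemma sinh_plus_mult_minus (r x : R) :
  sinh r ^ 2 - sinh x ^ 2 = sinh (r + x) * sinh (r - x).
Proof.
  unfold sinh.
  replace (- (r + x)) with (- r + - x) by ring.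
  replace (- (r - x)) with (- r + x) by ring.
  replace (exp (r - x)) with (exp r * exp (- x)) by (rewrite <- exp_plus; reflexivity).
  rewrite !exp_plus.
  assert (H1 : exp x * exp (- x) = 1) by (rewrite <- exp_plus, Rplus_opp_r; apply exp_0).
  assert (H2 : exp r * exp (- r) = 1) by (rewrite <- exp_plus, Rplus_opp_r; apply exp_0).
  set (a := exp x) in *. set (b := exp (- x)) in *.
  set (p := exp r) in *. set (q := exp (- r)) in *.
  transitivity ((p * p * (a * b) + q * q * (a * b) - a * a * (p * q) - b * b * (p * q)) / 4).
  - rewrite H1, H2. field_simplify. nra.
  - field.
Qed.

Lemma sinh_ge (x : R) : 0 <= x -> x <= sinh x.
Proof.
  intros [Hx| <-]; [|rewrite sinh_0; lra].
  destruct (MVT_cor2 sinh cosh 0 x Hx) as (t & Ht & _).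
  - intros; apply derivable_pt_lim_sinh.
  - rewrite sinh_0 in Ht.
    assert (1 <= cosh t).
    { assert (H := cosh2_sinh2 t). assert (H' := cosh_pos t). nra. }
    nra.
Qed.

Lemma cosh_le (x y : R) : 0 <= x <= y -> cosh x <= cosh y.
Proof.
  intros Hxy. assert (Hx := sinh_ge x ltac:(lra)).
  assert (Hs : sinh x <= sinh y).
  { destruct (proj2 Hxy) as [H| ->]; [left; now apply sinh_lt | apply Rle_refl]. }
  assert (H1 := cosh2_sinh2 x). assert (H2 := cosh2_sinh2 y).
  assert (H3 := cosh_pos x). assert (H4 := cosh_pos y). nra.
Qed.

(** The mean slopes on [[0, t a]] and [[t a, a]] are values of [cosh] at ordered points, so the
    first is at most the second. *)
Lemma sinh_convex (t a : R) : 0 <= t <= 1 -> 0 <= a -> sinh (t * a) <= t * sinh a.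
Proof.
  intros Ht Ha.
  destruct (Req_dec (t * a) 0) as [H0|H0].
  { rewrite H0, sinh_0. apply Rmult_le_pos; [lra|]. generalize (sinh_ge a Ha). lra. }
  destruct (Req_dec (t * a) a) as [H1|H1].
  { rewrite H1. replace t with 1; [lra|]. nra. }
  assert (Hta : 0 < t * a < a) by (split; [nra|]; destruct (Rle_lt_dec a (t * a)); [nra | lra]).
  destruct (MVT_cor2 sinh cosh 0 (t * a)) as (x & Hx & Hx1); [lra|intros; apply derivable_pt_lim_sinh|].
  destruct (MVT_cor2 sinh cosh (t * a) a) as (y & Hy & Hy1); [lra|intros; apply derivable_pt_lim_sinh|].
  rewrite sinh_0 in Hx.
  assert (Hc : cosh x <= cosh y) by (apply cosh_le; lra).
  assert (Ht1 : 0 < 1 - t) by nra.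
  assert (0 <= a * t * (1 - t) * (cosh y - cosh x)).
  { apply Rmult_le_pos; [|lra]. apply Rmult_le_pos; [nra|lra]. }
  assert (sinh (t * a) = cosh x * (t * a)) by lra.
  assert (sinh a = cosh x * (t * a) + cosh y * (a - t * a)) by lra.
  rewrite H2, H3. nra.
Qed.

(* [sinh^2 |u| - sinh^2 (Re u) = sinh (|u| + Re u) sinh (|u| - Re u) >= (Im u)^2]. *)
Lemma Cmod_Csinh (u : C) : Cmod (Csinh u) <= sinh (Cmod u).
Proof.
  assert (Hr := Cmod_ge_0 u).
  assert (Hs := sinh_ge _ Hr).
  assert (Hsq : Cmod (Csinh u) ^ 2 <= sinh (Cmod u) ^ 2).
  { rewrite Cmod2_alt, Csinh_coord. unfold Re, Im; simpl fst; simpl snd.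
    assert (Hre := re_le_Cmod u). unfold Re in Hre. apply Rabs_le_between in Hre.
    assert (H1 := sinh_plus_mult_minus (Cmod u) (fst u)).
    assert (H2 := sinh_ge (Cmod u + fst u) ltac:(lra)).
    assert (H3 := sinh_ge (Cmod u - fst u) ltac:(lra)).
    assert (H4 : (Cmod u + fst u) * (Cmod u - fst u) = snd u ^ 2).
    { assert (H := Cmod2_alt u). unfold Re, Im in H. nra. }
    assert (H5 : (Cmod u + fst u) * (Cmod u - fst u)
                 <= sinh (Cmod u + fst u) * sinh (Cmod u - fst u))
      by (apply Rmult_le_compat; lra).
    assert (H6 : sin (snd u) ^ 2 <= snd u ^ 2).
    { assert (Hp : forall x, 0 <= x -> sin x ^ 2 <= x ^ 2).
      { intros x [Hx| <-]; [|rewrite sin_0; lra].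
        assert (G1 := sin_lt_x x Hx).
        destruct (Rle_lt_dec x 1) as [Hx1|Hx1].
        - assert (0 <= sin x) by (apply sin_ge_0; [lra|]; generalize PI2_1; lra). nra.
        - generalize (SIN_bound x). nra. }
      destruct (Rle_lt_dec 0 (snd u)) as [Hu|Hu]; [now apply Hp|].
      specialize (Hp (- snd u) ltac:(lra)). rewrite sin_neg in Hp. nra. }
    assert (H7 := cosh2_sinh2 (fst u)).
    assert (H8 := sin2_cos2 (snd u)). unfold Rsqr in H8.
    (* The squared modulus of [sinh (x + i y)] is [sinh^2 x + sin^2 y]. *)
    replace ((sinh (fst u) * cos (snd u)) ^ 2 + (cosh (fst u) * sin (snd u)) ^ 2)
      with (sinh (fst u) ^ 2 + sin (snd u) ^ 2).
    - lra.
    - transitivity (sinh (fst u) ^ 2 * (sin (snd u) * sin (snd u) + cos (snd u) * cos (snd u))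
        + (cosh (fst u) ^ 2 - sinh (fst u) ^ 2) * sin (snd u) ^ 2).
      + rewrite H8, H7. ring.
      + ring. }
  assert (Hc := Cmod_ge_0 (Csinh u)). nra.
Qed.

(** * The principal inverse hyperbolic sine *)

Definition Cpolar (r th : R) : C := (r * cos th, r * sin th).

Lemma Cmod_polar (r th : R) : 0 <= r -> Cmod (Cpolar r th) = r.
Proof.
  intros Hr. unfold Cmod, Cpolar; simpl fst; simpl snd.
  replace ((r * cos th) ^ 2 + (r * sin th) ^ 2) with (r ^ 2 * (Rsqr (sin th) + Rsqr (cos th)))
    by (unfold Rsqr; ring).
  rewrite sin2_cos2, Rmult_1_r. now apply sqrt_pow2.
Qed.

Lemma Carg_polar (r th : R) : 0 < r -> - PI < th <= PI -> Carg (Cpolar r th) = th.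
Proof.
  intros Hr Hth. unfold Carg. rewrite Cmod_polar by lra.
  unfold Cpolar, Re, Im; simpl.
  replace (r * cos th / r) with (cos th) by (field; lra).
  destruct (Rlt_dec (r * sin th) 0) as [H|H].
  - destruct (Rle_lt_dec 0 th) as [H0|H0].
    + assert (0 <= sin th) by (apply sin_ge_0; lra). nra.
    + rewrite <- (cos_neg th), acos_cos; lra.
  - destruct (Rle_lt_dec 0 th) as [H0|H0].
    + apply acos_cos; lra.
    + assert (sin th < 0) by (apply sin_lt_0_var; lra). nra.
Qed.

Lemma Carg_spec (z : C) : z <> 0%C -> z = Cpolar (Cmod z) (Carg z).
Proof.
  intros Hz. assert (Hm : 0 < Cmod z) by now apply Cmod_gt_0.
  assert (H2 := Cmod2_alt z).
  assert (Hre := re_le_Cmod z). apply Rabs_le_between in Hre.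
  assert (Ht : -1 <= Re z / Cmod z <= 1).
  { split; [apply Rle_div_r | apply Rle_div_l]; lra. }
  assert (Hc := cos_acos _ Ht).
  assert (Hs : 0 <= sin (acos (Re z / Cmod z))) by (apply sin_ge_0; apply acos_bound).
  assert (Hsc := sin2_cos2 (acos (Re z / Cmod z))). unfold Rsqr in Hsc. rewrite Hc in Hsc.
  set (s := sin (acos (Re z / Cmod z))) in *.
  assert (Hsq : (Cmod z * s) ^ 2 = Im z ^ 2).
  { replace ((Cmod z * s) ^ 2) with (Cmod z ^ 2 * (s * s)) by ring.
    replace (s * s) with (1 - Re z / Cmod z * (Re z / Cmod z)) by lra.
    replace (Cmod z ^ 2 * (1 - Re z / Cmod z * (Re z / Cmod z)))
      with (Cmod z ^ 2 - Re z ^ 2) by (field; lra).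
    lra. }
  assert (Hns : 0 <= Cmod z * s) by (apply Rmult_le_pos; lra).
  unfold Cpolar, Carg. unfold Re, Im in *.
  apply injective_projections; simpl fst; simpl snd;
  destruct (Rlt_dec (snd z) 0) as [Hi|Hi]; try rewrite cos_neg; try rewrite sin_neg;
  try rewrite Hc; fold s.
  - field. lra.
  - field. lra.
  - nra.
  - nra.
Qed.

Lemma Carg_Re_pos (z : C) : 0 < Re z -> - (PI / 2) < Carg z < PI / 2.
Proof.
  intros Hz.
  assert (Hn : z <> 0%C) by (intros ->; simpl in Hz; lra).
  assert (Hm : 0 < Cmod z) by now apply Cmod_gt_0.
  assert (Hre := re_le_Cmod z). apply Rabs_le_between in Hre.
  assert (Ht : -1 <= Re z / Cmod z <= 1).
  { split; [apply Rle_div_r | apply Rle_div_l]; lra. }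
  assert (Hc := cos_acos _ Ht).
  assert (Hp : 0 < Re z / Cmod z) by now apply Rdiv_lt_0_compat.
  assert (Hb := acos_bound (Re z / Cmod z)).
  assert (Hlt : acos (Re z / Cmod z) < PI / 2).
  { destruct (Rlt_le_dec (acos (Re z / Cmod z)) (PI / 2)) as [H|H]; [exact H|].
    assert (cos (acos (Re z / Cmod z)) <= 0) by (apply cos_le_0; lra). lra. }
  assert (HP := PI_RGT_0).
  unfold Carg. destruct (Rlt_dec (Im z) 0); lra.
Qed.

Lemma Cpolar_mult (r s th ph : R) :
  (Cpolar r th * Cpolar s ph)%C = Cpolar (r * s) (th + ph).
Proof.
  unfold Cpolar, Cmult; simpl. rewrite cos_plus, sin_plus. f_equal; ring.
Qed.

Lemma Csqrt_polar (z : C) : Csqrt z = Cpolar (sqrt (Cmod z)) (Carg z / 2).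
Proof. unfold Csqrt, Cpolar, Cmult, RtoC; simpl. f_equal; ring. Qed.

Lemma Csqrt_sqr (z : C) : (Csqrt z * Csqrt z)%C = z.
Proof.
  rewrite Csqrt_polar, Cpolar_mult, sqrt_sqrt by apply Cmod_ge_0.
  replace (Carg z / 2 + Carg z / 2) with (Carg z) by field.
  destruct (Ceq_dec z 0) as [->|Hz]; [|symmetry; now apply Carg_spec].
  rewrite Cmod_0. unfold Cpolar, RtoC. f_equal; ring.
Qed.

(** On the right half-plane the argument is less than [PI / 2] in absolute value, so doubling it
    stays in the principal range. *)
Lemma Csqrt_of_sqr (w : C) : 0 < Re w -> Csqrt (w * w)%C = w.
Proof.
  intros Hw.
  assert (Hn : w <> 0%C) by (intros ->; simpl in Hw; lra).
  assert (Hm : 0 < Cmod w) by now apply Cmod_gt_0.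
  assert (Ha := Carg_Re_pos w Hw).
  assert (Hww : (w * w)%C = Cpolar (Cmod w * Cmod w) (Carg w + Carg w)).
  { rewrite <- Cpolar_mult, <- Carg_spec; auto. }
  rewrite Csqrt_polar, Cmod_mult, sqrt_square by lra.
  rewrite Hww, Carg_polar by nra.
  replace ((Carg w + Carg w) / 2) with (Carg w) by field.
  symmetry. now apply Carg_spec.
Qed.

Lemma Cln_Cexp (u : C) : - PI < snd u <= PI -> Cln (Cexp u) = u.
Proof.
  intros Hu. unfold Cln.
  change (Cexp u) with (Cpolar (exp (fst u)) (snd u)).
  rewrite Cmod_polar by (left; apply exp_pos).
  rewrite ln_exp, Carg_polar; [|apply exp_pos | exact Hu].
  now destruct u.
Qed.

Lemma Cexp_Cln (z : C) : z <> 0%C -> Cexp (Cln z) = z.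
Proof.
  intros Hz. unfold Cexp, Cln; simpl. rewrite exp_ln by now apply Cmod_gt_0.
  symmetry. now apply Carg_spec.
Qed.

(** [1 + sinh^2 = cosh^2], and in this strip [Re (Ccosh u) = cosh x cos y] is positive, so the
    principal root returns [Ccosh u]; finally [sinh + cosh = exp]. *)
Lemma Casinh_Csinh (u : C) : - (PI / 2) < snd u < PI / 2 -> Casinh (Csinh u) = u.
Proof.
  intros Hu. assert (HP := PI_RGT_0). unfold Casinh.
  replace (1 + Csinh u * Csinh u)%C with (Ccosh u * Ccosh u)%C.
  2:{ transitivity (Csinh u * Csinh u + Cexp u * Cexp (- u))%C.
      - unfold Csinh, Ccosh. field.
      - rewrite Cexp_opp_r. ring. }
  rewrite Csqrt_of_sqr.
  - replace (Csinh u + Ccosh u)%C with (Cexp u) by (unfold Csinh, Ccosh; field).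
    apply Cln_Cexp. lra.
  - rewrite Ccosh_coord. unfold Re; simpl.
    apply Rmult_lt_0_compat; [apply cosh_pos | apply cos_gt_0; lra].
Qed.

(** No branch question arises: for any root [s] of [1 + w ^ 2], [(w + s) (s - w) = 1]. Hence
    [w + s = exp y] forces [s - w = exp (- y)], and half the difference is [w]. *)
Lemma Casinh_real (w : C) (y : R) : Casinh w = RtoC y -> w = RtoC (sinh y).
Proof.
  unfold Casinh. intros H.
  set (s := Csqrt (1 + w * w)%C) in *.
  assert (Hs : (s * s = 1 + w * w)%C) by apply Csqrt_sqr.
  assert (H1 : ((w + s) * (s - w) = 1)%C).
  { replace ((w + s) * (s - w))%C with (s * s - w * w)%C by ring. rewrite Hs. ring. }
  assert (Hn : (w + s <> 0)%C).
  { intros H0. rewrite H0, Cmult_0_l in H1. apply RtoC_inj in H1. lra. }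
  assert (H2 := Cexp_Cln _ Hn). rewrite H, Cexp_RtoC in H2.
  assert (H3 : (s - w)%C = RtoC (exp (- y))).
  { transitivity (RtoC (exp (- y)) * ((w + s) * (s - w)))%C; [|rewrite H1; ring].
    rewrite <- H2.
    replace (RtoC (exp (- y)) * (RtoC (exp y) * (s - w)))%C
      with (RtoC (exp (- y)) * RtoC (exp y) * (s - w))%C by ring.
    rewrite <- RtoC_mult, <- exp_plus, Rplus_opp_l, exp_0. ring. }
  unfold sinh. rewrite RtoC_div by lra. rewrite RtoC_minus, H2, <- H3. field.
Qed.

(** * The lower bound for the radius *)

Lemma Cmod_scale (r : R) (z : C) : 0 <= r -> Cmod (RtoC r * z) = r * Cmod z.
Proof. intros Hr. now rewrite Cmod_mult, Cmod_R, Rabs_pos_eq. Qed.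

Lemma in_disk_scale (r : R) (z : C) : 0 < r <= 1 -> in_disk z -> in_disk (RtoC r * z)%C.
Proof.
  unfold in_disk. intros Hr Hz. rewrite Cmod_scale by lra.
  generalize (Cmod_ge_0 z). nra.
Qed.

Lemma RtoC_neq_0 (r : R) : r <> 0 -> RtoC r <> RtoC 0.
Proof. intros Hr H. apply RtoC_inj in H. contradiction. Qed.

Lemma Cinv_neq_0 (z : C) : z <> RtoC 0 -> (/ z)%C <> RtoC 0.
Proof.
  intros Hz H. assert (H1 := Cinv_r z Hz). rewrite H, Cmult_0_r in H1.
  apply RtoC_inj in H1. lra.
Qed.

Lemma is_Cderive_scale (g : C -> C) (r : R) (z l : C) :
  is_Cderive g (RtoC r * z)%C l -> is_Cderive (fun y => g (RtoC r * y)%C) z (RtoC r * l)%C.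
Proof.
  intros H. apply (is_Cderive_comp g (fun y => RtoC r * y)%C); [exact H|].
  eapply is_Cderive_eq;
    [exact (is_Cderive_mult (fun _ => RtoC r) (fun y => y) z _ _
              (is_Cderive_const _ z) (is_Cderive_id z)) | cbv beta; ring].
Qed.

Lemma is_Cderive_dilate (g : C -> C) (r : R) (z l : C) :
  r <> 0 -> is_Cderive g (RtoC r * z)%C l -> is_Cderive (dilate r g) z l.
Proof.
  intros Hr H. apply is_Cderive_scale in H.
  eapply is_Cderive_eq;
    [exact (is_Cderive_mult (fun _ => / RtoC r)%C _ z _ _ (is_Cderive_const _ z) H)|].
  cbv beta. field. now apply RtoC_neq_0.
Qed.

Lemma C_derive_eq (f : C -> C) (z l : C) : is_Cderive f z l -> C_derive f z = l.
Proof. apply is_C_derive_unique. Qed.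

Lemma zf'_over_f_dilate (g : C -> C) (r : R) (z : C) :
  0 < r <= 1 -> in_disk z -> analytic_on_disk g ->
  (forall y, in_disk y -> y <> RtoC 0 -> g y <> RtoC 0) ->
  zf'_over_f (dilate r g) z = zf'_over_f g (RtoC r * z)%C.
Proof.
  intros Hr Hz Hg Hg0.
  assert (Hr0 : RtoC r <> RtoC 0) by (apply RtoC_neq_0; lra).
  assert (Hrz := in_disk_scale r z Hr Hz).
  unfold zf'_over_f.
  destruct (Ceq_dec z (RtoC 0)) as [->|Hz0].
  - rewrite Cmult_0_r. destruct (Ceq_dec (RtoC 0) (RtoC 0)); [reflexivity | contradiction].
  - assert (Hrz0 : (RtoC r * z)%C <> RtoC 0) by now apply Cmult_neq_0.
    destruct (Ceq_dec (RtoC r * z) (RtoC 0)); [contradiction|].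
    destruct (Hg _ Hrz) as [l Hl].
    rewrite (C_derive_eq _ _ _ Hl), (C_derive_eq _ _ l); [|apply is_Cderive_dilate; [lra | exact Hl]].
    unfold dilate. specialize (Hg0 _ Hrz Hrz0). field. auto.
Qed.

Lemma class_A_dilate (n : nat) (g : C -> C) (r : R) :
  0 < r <= 1 -> class_A n g -> class_A n (dilate r g).
Proof.
  intros Hr (Hg & a & Ha0 & Ha1 & Hak & Ha).
  assert (Hr0 : RtoC r <> RtoC 0) by (apply RtoC_neq_0; lra).
  split.
  - intros z Hz. destruct (Hg _ (in_disk_scale r z Hr Hz)) as [l Hl].
    exists l. apply is_Cderive_dilate; [lra | exact Hl].
  - exists (fun k => / RtoC r * (RtoC r ^ k * a k))%C. repeat split.
    + rewrite Ha0. simpl. ring.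
    + rewrite Ha1. simpl. field. exact Hr0.
    + intros k Hk. rewrite Hak by exact Hk. ring.
    + intros z Hz. specialize (Ha _ (in_disk_scale r z Hr Hz)).
      apply (proj1 (is_pseries_C _ _ _)) in Ha. apply is_pseries_C.
      apply (filterlim_C_affine _ _ (RtoC 0) (/ RtoC r)) in Ha.
      rewrite Cplus_0_l in Ha. eapply filterlim_ext; [|exact Ha].
      intros m. simpl. rewrite Cplus_0_l. unfold psum.
      transitivity (sum_n (G := C_AbelianMonoid)
        (fun k => mult (K := C_Ring) (/ RtoC r)%C ((RtoC r * z) ^ k * a k)%C) m).
      * symmetry. apply (sum_n_mult_l (K := C_Ring)).
      * apply sum_n_ext. intros k. change mult with Cmult. rewrite Cpow_mult_l.
        match goal with |- ?u = ?v => change (@eq C u v) end. ring.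
Qed.

Lemma class_A_1 (n : nat) (f : C -> C) : class_A n f -> class_A 1 f.
Proof.
  intros (Hf & a & Ha0 & Ha1 & _ & Ha). split; [exact Hf|].
  exists a. repeat split; auto. intros k Hk. lia.
Qed.

Lemma analytic_quotient_dilate (g : C -> C) (r : R) :
  0 < r <= 1 -> analytic_on_disk g -> analytic_quotient g -> analytic_quotient (dilate r g).
Proof.
  intros Hr Hg [Hg0 Hq].
  assert (Hr0 : RtoC r <> RtoC 0) by (apply RtoC_neq_0; lra).
  split.
  - intros z Hz Hz0. unfold dilate. apply Cmult_neq_0; [now apply Cinv_neq_0|].
    apply Hg0; [now apply in_disk_scale | now apply Cmult_neq_0].
  - intros z Hz. destruct (Hq _ (in_disk_scale r z Hr Hz)) as [l Hl].
    eexists. apply (is_Cderive_ext_disk (fun y => zf'_over_f g (RtoC r * y)%C)); [exact Hz| |].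
    + intros y Hy. symmetry. now apply zf'_over_f_dilate.
    + exact (is_Cderive_scale _ _ _ _ Hl).
Qed.

Lemma arcsinh_1_pos : 0 < arcsinh 1.
Proof. rewrite <- arcsinh_0. apply arcsinh_lt. lra. Qed.

(** From [sinh (PI / 2) >= PI / 2 > 1]. It keeps the disk of radius [arcsinh 1] inside the strip
    where [Casinh] inverts [Csinh]. *)
Lemma arcsinh_1_lt_PI2 : arcsinh 1 < PI / 2.
Proof.
  assert (H := PI2_1). rewrite <- (arcsinh_sinh (PI / 2)). apply arcsinh_lt.
  generalize (sinh_ge (PI / 2)). lra.
Qed.

(* The disk [|w - 1| < arcsinh 1] lies in the image of [one_plus_asinh]: there
   [w = one_plus_asinh (Csinh (w - 1))], and [|Csinh u| <= sinh |u|]. *)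
Lemma radius_property_S_rho (n : nat) (c d r0 : R) :
  (1 <= n)%nat -> d < c -> -1 <= d <= 1 -> 0 < r0 <= 1 ->
  (c - d) * r0 ^ n <= arcsinh 1 * (1 - Rabs d * r0 ^ n) ->
  radius_property (class_S_rho_n n) (class_S n c d) r0.
Proof.
  intros Hn Hcd Hd Hr0 Hle g (HA & HQ & HP) r Hr.
  assert (Hr1 : 0 < r <= 1) by lra.
  pose proof (proj1 HA) as Hg.
  assert (HA' := class_A_dilate n g r Hr1 HA).
  assert (HQ' := analytic_quotient_dilate g r Hr1 Hg HQ).
  split; [exact HA'|]. split; [now apply class_A_1 in HA'|]. split; [exact HQ'|].
  set (p := zf'_over_f (dilate r g)).
  assert (Ha := arcsinh_1_pos).
  assert (Hx0 : 0 < r0 ^ n) by (apply pow_lt; lra).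
  assert (Hd0 := Rabs_pos d).
  (* The factor [|z| ^ n] is kept because subordination asks for [|w z| <= |z|], not just for values
     in the disk. *)
  assert (Hbound : forall z, in_disk z -> Cmod (p z - 1) <= Cmod z ^ n * arcsinh 1).
  { intros z Hz. unfold p. rewrite zf'_over_f_dilate; [|exact Hr1 | exact Hz | exact Hg | apply HQ].
    assert (Hb := class_P_bound n c d _ _ Hn Hcd Hd HP (in_disk_scale r z Hr1 Hz)).
    rewrite Cmod_scale, Rpow_mult_distr in Hb by lra.
    set (P := Cmod (zf'_over_f g (RtoC r * z) - 1)) in *.
    assert (Ht : 0 <= Cmod z ^ n <= 1).
    { split; [apply pow_le, Cmod_ge_0|]. rewrite <- (pow1 n).
      apply pow_incr. split; [apply Cmod_ge_0 | left; exact Hz]. }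
    assert (Hx : 0 < r ^ n <= r0 ^ n) by (split; [apply pow_lt | apply pow_incr]; lra).
    set (t := Cmod z ^ n) in *. set (x := r ^ n) in *. set (x0 := r0 ^ n) in *.
    assert (HX : 0 <= x * t <= x0 * t) by (split; [nra|]; apply Rmult_le_compat_r; lra).
    assert (HX0 : x0 * t <= x0) by nra.
    (* Positivity comes from the radius condition, whose left side is positive; it excludes the case
       [|d| = r0 = 1]. *)
    assert (Hden : 0 < 1 - Rabs d * x0) by nra.
    assert (Hden' : 1 - Rabs d * x0 <= 1 - Rabs d * (x * t)) by nra.
    assert (HP0 : 0 <= P) by apply Cmod_ge_0.
    apply (Rmult_le_reg_r (1 - Rabs d * (x * t))); [lra|].
    apply Rle_trans with (t * (arcsinh 1 * (1 - Rabs d * x0))).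
    - apply Rle_trans with (t * ((c - d) * x0)); [nra|].
      apply Rmult_le_compat_l; lra.
    - rewrite Rmult_assoc. apply Rmult_le_compat_l; [lra|].
      apply Rmult_le_compat_l; lra. }
  exists (fun z => Csinh (p z - 1)%C). repeat split.
  - intros z Hz. destruct HQ' as [_ Hq]. destruct (Hq z Hz) as [l Hl].
    eexists. apply (is_Cderive_comp Csinh (fun y => p y - 1)%C); [apply is_Cderive_Csinh|].
    apply (is_Cderive_minus p); [exact Hl | apply is_Cderive_const].
  - unfold p, zf'_over_f. destruct (Ceq_dec (RtoC 0) (RtoC 0)); [|contradiction].
    replace (1 - 1)%C with (RtoC 0) by ring. apply Csinh_0.
  - intros z Hz. specialize (Hbound z Hz).
    eapply Rle_trans; [apply Cmod_Csinh|].
    assert (Hz0 := Cmod_ge_0 z). unfold in_disk in Hz.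
    assert (Ht : 0 <= Cmod z ^ n <= Cmod z).
    { split; [now apply pow_le|]. destruct n as [|m]; [lia|]. simpl.
      apply Rle_trans with (Cmod z * 1); [|lra]. apply Rmult_le_compat_l; [exact Hz0|].
      rewrite <- (pow1 m). apply pow_incr. lra. }
    apply Rle_trans with (sinh (Cmod z ^ n * arcsinh 1)).
    + destruct Hbound as [H|H]; [left; now apply sinh_lt | rewrite H; lra].
    + eapply Rle_trans; [apply sinh_convex; lra|]. rewrite sinh_arcsinh. lra.
  - intros z Hz. specialize (Hbound z Hz). unfold one_plus_asinh.
    rewrite Casinh_Csinh; [fold p; ring|].
    assert (Hpi := arcsinh_1_lt_PI2).
    assert (Hm := Rmax_Cmod (p z - 1)%C).
    assert (Hm2 := Rmax_r (Rabs (fst (p z - 1)%C)) (Rabs (snd (p z - 1)%C))).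
    assert (Ht : Cmod z ^ n <= 1).
    { rewrite <- (pow1 n). apply pow_incr. split; [apply Cmod_ge_0 | left; exact Hz]. }
    apply Rabs_lt_between. nra.
Qed.

(** * Binomial series *)

Lemma psum_linear (a b : nat -> C) (A B z : C) (n : nat) :
  psum (fun k => A * a k + B * b k)%C z n = (A * psum a z n + B * psum b z n)%C.
Proof.
  unfold psum. induction n as [|n IH].
  - rewrite !sum_O. simpl. ring.
  - rewrite !sum_Sn, IH. change plus with Cplus. ring.
Qed.

Lemma coef_bounded_linear (a b : nat -> C) (A B : C) :
  coef_bounded a -> coef_bounded b -> coef_bounded (fun k => A * a k + B * b k)%C.
Proof.
  intros Ha Hb s Hs. destruct (Ha s Hs) as [K HK]. destruct (Hb s Hs) as [L HL].
  exists (Cmod A * K + Cmod B * L). intros k.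
  assert (Hsk : 0 <= s ^ k) by (apply pow_le; lra).
  apply Rle_trans with ((Cmod A * Cmod (a k) + Cmod B * Cmod (b k)) * s ^ k).
  - apply Rmult_le_compat_r; [exact Hsk|]. rewrite <- !Cmod_mult. apply Cmod_triangle.
  - rewrite Rmult_plus_distr_r, !Rmult_assoc.
    apply Rplus_le_compat; (apply Rmult_le_compat_l; [apply Cmod_ge_0|]); [apply HK | apply HL].
Qed.

Lemma csum_linear (a b : nat -> C) (A B z : C) :
  coef_bounded a -> coef_bounded b -> in_disk z ->
  csum (fun k => A * a k + B * b k)%C z = (A * csum a z + B * csum b z)%C.
Proof.
  intros Ha Hb Hz.
  pose proof (csum_correct _ (coef_bounded_linear a b A B Ha Hb) z Hz) as H.
  pose proof (csum_correct _ Ha z Hz) as H1. pose proof (csum_correct _ Hb z Hz) as H2.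
  apply (proj1 (is_pseries_C _ _ _)) in H. apply (proj1 (is_pseries_C _ _ _)) in H1.
  apply (proj1 (is_pseries_C _ _ _)) in H2.
  apply (filterlim_C_unique _ _ _ H).
  apply (filterlim_C_affine _ _ (RtoC 0) A) in H1.
  apply (filterlim_C_affine _ _ (RtoC 0) B) in H2.
  pose proof (filterlim_comp_2 (F := eventually) _ _ Cplus H1 H2
    (filterlim_plus (K := C_AbsRing) (V := C_NormedModule) _ _)) as H4.
  change plus with Cplus in H4. rewrite !Cplus_0_l in H4.
  eapply filterlim_ext; [|exact H4]. intros n. simpl.
  rewrite psum_linear. ring.
Qed.

(* Taylor coefficients at 0 of [(1 - e z) ^ (- beta)]. *)
Fixpoint binom_coef (beta e : R) (k : nat) : R :=
  match k with
  | O => 1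
  | S k => e * (beta + INR k) / INR (S k) * binom_coef beta e k
  end.

Lemma binom_coef_S (beta e : R) (k : nat) :
  binom_coef beta e (S k) = e * (beta + INR k) / INR (S k) * binom_coef beta e k.
Proof. reflexivity. Qed.

Lemma eventually_decreasing_bounded (u : nat -> R) (N : nat) :
  (forall k, 0 <= u k) -> (forall k, (N <= k)%nat -> u (S k) <= u k) ->
  exists K, forall k, u k <= K.
Proof.
  intros Hu Hdec. exists (sum_f_R0 u N).
  assert (Hle : forall m k, (k <= m)%nat -> u k <= sum_f_R0 u m).
  { intros m. induction m as [|m IH]; intros k Hk.
    - replace k with 0%nat by lia. apply Rle_refl.
    - simpl. destruct (Nat.eq_dec k (S m)) as [->|Hne].
      + generalize (cond_pos_sum u m Hu). lra.
      + specialize (IH k ltac:(lia)). generalize (Hu (S m)). lra. }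
  intros k. destruct (le_lt_dec k N) as [Hk|Hk]; [now apply Hle|].
  apply Rle_trans with (u N); [|now apply Hle].
  induction Hk as [|k Hk IH]; [now apply Hdec|].
  eapply Rle_trans; [apply Hdec; lia | exact IH].
Qed.

(** Ratio test: [(|beta| + k) s <= k + 1] once [k (1 - s)] exceeds [|beta|]. *)
Lemma binom_coef_bounded (beta e : R) :
  0 <= e <= 1 -> coef_bounded (fun k => RtoC (binom_coef beta e k)).
Proof.
  intros He s Hs.
  destruct (INR_unbounded (Rabs beta / (1 - s))) as [N HN].
  apply (eventually_decreasing_bounded _ N).
  - intros k. apply Rmult_le_pos; [apply Cmod_ge_0 | apply pow_le; lra].
  - intros k Hk. rewrite !Cmod_R, binom_coef_S, Rabs_mult.
    assert (Hkn : Rabs beta < INR k * (1 - s)).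
    { apply le_INR in Hk. apply (Rmult_lt_compat_r (1 - s)) in HN; [|lra].
      unfold Rdiv in HN. rewrite Rmult_assoc, Rinv_l, Rmult_1_r in HN by lra. nra. }
    assert (HS : INR (S k) = INR k + 1) by apply S_INR.
    assert (Hk0 := pos_INR k).
    assert (Hratio : Rabs (e * (beta + INR k) / INR (S k)) * s <= 1).
    { rewrite HS. unfold Rdiv. rewrite !Rabs_mult, (Rabs_pos_eq e), (Rabs_pos_eq (/ _)).
      - assert (Ht : Rabs (beta + INR k) <= Rabs beta + INR k).
        { eapply Rle_trans; [apply Rabs_triang|]. rewrite (Rabs_pos_eq (INR k)); lra. }
        assert (Hb := Rabs_pos (beta + INR k)).
        apply (Rmult_le_reg_r (INR k + 1)); [lra|].
        replace (e * Rabs (beta + INR k) * / (INR k + 1) * s * (INR k + 1))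
          with (e * (Rabs (beta + INR k) * s)) by (field; lra).
        assert (HB := Rabs_pos beta).
        assert (Rabs (beta + INR k) * s <= (Rabs beta + INR k) * s)
          by (apply Rmult_le_compat_r; lra).
        assert (Rabs beta * s <= Rabs beta * 1) by (apply Rmult_le_compat_l; lra).
        assert (0 <= Rabs (beta + INR k) * s) by (apply Rmult_le_pos; lra).
        nra.
      - left. apply Rinv_0_lt_compat. lra.
      - lra. }
    simpl pow.
    replace (Rabs (e * (beta + INR k) / INR (S k)) * Rabs (binom_coef beta e k) * (s * s ^ k))
      with (Rabs (e * (beta + INR k) / INR (S k)) * s * (Rabs (binom_coef beta e k) * s ^ k)) by ring.
    apply Rle_trans with (1 * (Rabs (binom_coef beta e k) * s ^ k)); [|lra].
    apply Rmult_le_compat_r; [|exact Hratio].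
    apply Rmult_le_pos; [apply Rabs_pos | apply pow_le; lra].
Qed.

Definition binom_fun (beta e : R) : C -> C := csum (fun k => RtoC (binom_coef beta e k)).
Definition binom_fun' (beta e : R) : C -> C :=
  csum (PS_derive_C (fun k => RtoC (binom_coef beta e k))).

Lemma is_Cderive_binom (beta e : R) (z : C) :
  0 <= e <= 1 -> in_disk z -> is_Cderive (binom_fun beta e) z (binom_fun' beta e z).
Proof. intros He Hz. apply csum_is_derive; [now apply binom_coef_bounded | exact Hz]. Qed.

(** The coefficient recursion [(k + 1) a_(k+1) = e (beta + k) a_k] read as an identity of series.
    With the value at 0 it stands in for the formula [(1 - e z) ^ (- beta)]. *)
Lemma binom_fun_ode (beta e : R) (z : C) :
  0 <= e <= 1 -> in_disk z ->
  ((1 - RtoC e * z) * binom_fun' beta e z = RtoC (e * beta) * binom_fun beta e z)%C.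
Proof.
  intros He Hz.
  set (a := fun k => RtoC (binom_coef beta e k)).
  assert (Ha : coef_bounded a) by now apply binom_coef_bounded.
  assert (Hka := coef_bounded_INR a Ha).
  assert (H1 : binom_fun' beta e z
    = csum (fun k => RtoC (e * beta) * a k + RtoC e * (RtoC (INR k) * a k))%C z).
  { unfold binom_fun'. f_equal. apply functional_extensionality. intros k.
    unfold PS_derive_C, a. rewrite binom_coef_S, <- !RtoC_mult, <- RtoC_plus. f_equal. field.
    rewrite S_INR. generalize (pos_INR k). lra. }
  assert (H2 : csum (fun k => RtoC (INR k) * a k)%C z = (z * binom_fun' beta e z)%C).
  { rewrite (csum_step _ z Hka Hz). unfold binom_fun', PS_derive_C, a.
    cbv beta. change (INR 0) with 0. ring. }
  rewrite (csum_linear _ _ _ _ z Ha Hka Hz), H2 in H1. fold (binom_fun beta e) in H1.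
  change (csum a z) with (binom_fun beta e z) in H1.
  transitivity (binom_fun' beta e z - RtoC e * (z * binom_fun' beta e z))%C; [ring|].
  rewrite H1 at 1. ring.
Qed.

Lemma binom_fun_0 (beta e : R) : 0 <= e <= 1 -> binom_fun beta e 0 = 1%C.
Proof.
  intros He. unfold binom_fun. rewrite csum_step.
  - simpl. ring.
  - now apply binom_coef_bounded.
  - unfold in_disk. rewrite Cmod_0. lra.
Qed.

(** Here [pr] is a real or imaginary part. Restriction to a segment from the origin reduces
    constancy of [H] to a real function with zero derivative. *)
Lemma is_Cderive_ray (H : C -> C) (z : C) (t : R) (pr : C -> R) :
  Cmod z <= 1 -> is_Cderive H (RtoC t * z)%C (RtoC 0) ->
  (forall u v, pr (u - v)%C = pr u - pr v) -> (forall w, Rabs (pr w) <= Cmod w) ->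
  is_derive (K := R_AbsRing) (V := R_NormedModule) (fun s => pr (H (RtoC s * z)%C)) t 0.
Proof.
  intros Hz [_ Hd] Hpr1 Hpr2. split; [apply is_linear_scal_l|].
  intros x Hx. apply (is_filter_lim_locally_unique (K := R_AbsRing) (V := R_NormedModule)) in Hx.
  subst x. intros eps.
  destruct (Hd _ (fun P HP => HP) eps) as [d Hdd].
  exists d. intros s Hs.
  assert (Hdist : Cmod (RtoC s * z - RtoC t * z) <= Rabs (s - t)).
  { replace (RtoC s * z - RtoC t * z)%C with (RtoC (s - t) * z)%C by (rewrite RtoC_minus; ring).
    rewrite Cmod_mult, Cmod_R. generalize (Rabs_pos (s - t)). nra. }
  assert (Hs' : Rabs (s - t) < d) by exact Hs.
  specialize (Hdd (RtoC s * z)%C (Rle_lt_trans _ _ _ Hdist Hs')).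
  change (Cmod (H (RtoC s * z)%C - H (RtoC t * z)%C - (RtoC s * z - RtoC t * z) * RtoC 0)%C
          <= eps * Cmod (RtoC s * z - RtoC t * z)%C) in Hdd.
  change (Rabs (pr (H (RtoC s * z)%C) - pr (H (RtoC t * z)%C) - (s - t) * 0)
          <= eps * Rabs (s - t)).
  rewrite Rmult_0_r, Rminus_0_r, <- Hpr1.
  eapply Rle_trans; [apply Hpr2|].
  replace (H (RtoC s * z)%C - H (RtoC t * z)%C)%C
    with (H (RtoC s * z)%C - H (RtoC t * z)%C - (RtoC s * z - RtoC t * z) * RtoC 0)%C by ring.
  eapply Rle_trans; [exact Hdd|]. apply Rmult_le_compat_l; [left; apply cond_pos | exact Hdist].
Qed.

Lemma zero_derivative_constant (H : C -> C) (z : C) :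
  (forall y, in_disk y -> is_Cderive H y (RtoC 0)) -> in_disk z -> H z = H (RtoC 0).
Proof.
  intros Hd Hz. unfold in_disk in Hz.
  assert (Hin : forall t, 0 <= t <= 1 -> in_disk (RtoC t * z)%C).
  { intros t Ht. unfold in_disk. rewrite Cmod_mult, Cmod_R, Rabs_pos_eq by lra.
    generalize (Cmod_ge_0 z). nra. }
  assert (Hpr : forall pr : C -> R, (forall u v, pr (u - v)%C = pr u - pr v) ->
    (forall w, Rabs (pr w) <= Cmod w) -> pr (H z) = pr (H (RtoC 0))).
  { intros pr H1 H2.
    assert (E := eq_is_derive (fun s => pr (H (RtoC s * z)%C)) 0 1).
    simpl in E. rewrite Cmult_0_l, Cmult_1_l in E. symmetry. apply E; [|lra].
    intros t Ht. apply is_Cderive_ray; auto. lra. }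
  apply injective_projections.
  - apply (Hpr fst); [reflexivity|]. intros w.
    eapply Rle_trans; [apply Rmax_l | apply Rmax_Cmod].
  - apply (Hpr snd); [reflexivity|]. intros w.
    eapply Rle_trans; [apply Rmax_r | apply Rmax_Cmod].
Qed.

Lemma one_minus_neq_0 (e : R) (z : C) :
  0 <= e <= 1 -> in_disk z -> (1 - RtoC e * z)%C <> RtoC 0.
Proof.
  intros He Hz H0. unfold in_disk in Hz.
  assert (H1 : Cmod (RtoC e * z) = 1).
  { replace (RtoC e * z)%C with (RtoC 1).
    - apply Cmod_1.
    - transitivity (RtoC 1 - (1 - RtoC e * z))%C; [rewrite H0|]; ring. }
  rewrite Cmod_scale in H1 by lra. generalize (Cmod_ge_0 z). nra.
Qed.

(** The product of the functions with exponents [beta] and [- beta] has zero derivative by the two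
    differential equations, so it is constantly 1. *)
Lemma binom_fun_neq_0 (beta e : R) (z : C) :
  0 <= e <= 1 -> in_disk z -> binom_fun beta e z <> RtoC 0.
Proof.
  intros He Hz H0.
  assert (Hc := zero_derivative_constant
    (fun y => binom_fun beta e y * binom_fun (- beta) e y)%C z).
  cbv beta in Hc. rewrite H0, !binom_fun_0, Cmult_0_l, Cmult_1_l in Hc by exact He.
  assert (E : RtoC 0 = RtoC 1).
  { apply Hc; [|exact Hz]. intros y Hy.
    eapply is_Cderive_eq; [apply is_Cderive_mult; now apply is_Cderive_binom|].
    assert (O1 := binom_fun_ode beta e y He Hy).
    assert (O2 := binom_fun_ode (- beta) e y He Hy).
    assert (Hn := one_minus_neq_0 e y He Hy).
    set (F := binom_fun beta e y) in *. set (G := binom_fun (- beta) e y) in *.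
    set (F' := binom_fun' beta e y) in *. set (G' := binom_fun' (- beta) e y) in *.
    transitivity (((1 - RtoC e * y) * F' * G + F * ((1 - RtoC e * y) * G')) / (1 - RtoC e * y))%C.
    - field. exact Hn.
    - rewrite O1, O2. replace (e * - beta) with (- (e * beta)) by ring. rewrite RtoC_opp.
      field. exact Hn. }
  apply RtoC_inj in E. lra.
Qed.

Definition spread (n : nat) (a : nat -> C) (k : nat) : C :=
  if Nat.eq_dec (k mod n) 0 then a (k / n)%nat else RtoC 0.

(** Only multiples of [n] contribute, so the partial sum stays constant between them. *)
Lemma psum_spread (n : nat) (a : nat -> C) (z : C) (N : nat) :
  (1 <= n)%nat -> psum (spread n a) z N = psum a (z ^ n)%C (N / n).
Proof.
  intros Hn. induction N as [|N IH].
  - rewrite Nat.Div0.div_0_l. unfold psum, spread. rewrite !sum_O.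
    rewrite Nat.Div0.mod_0_l, Nat.Div0.div_0_l. simpl. reflexivity.
  - unfold psum at 1. rewrite sum_Sn. change plus with Cplus.
    fold (psum (spread n a) z N). rewrite IH. unfold spread.
    assert (HN := Nat.div_mod N n ltac:(lia)). assert (HNr := Nat.mod_upper_bound N n ltac:(lia)).
    destruct (Nat.eq_dec (S N mod n) 0) as [H0|H0].
    + assert (HS := Nat.div_mod (S N) n ltac:(lia)). rewrite H0 in HS.
      assert (Hq : (S N / n)%nat = S (N / n)) by nia.
      rewrite Hq. unfold psum at 2. rewrite sum_Sn. change plus with Cplus.
      rewrite <- Cpow_mult_r, <- Hq. do 3 f_equal. lia.
    + assert (HS := Nat.div_mod (S N) n ltac:(lia)).
      assert (HSr := Nat.mod_upper_bound (S N) n ltac:(lia)).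
      assert (Hq : (S N / n)%nat = (N / n)%nat) by nia.
      rewrite Hq. ring.
Qed.

Lemma in_disk_pow (n : nat) (z : C) : (1 <= n)%nat -> in_disk z -> Cmod (z ^ n) <= Cmod z.
Proof.
  intros Hn Hz. unfold in_disk in Hz. rewrite Cmod_pow.
  assert (Hz0 := Cmod_ge_0 z). destruct n as [|m]; [lia|]. simpl.
  apply Rle_trans with (Cmod z * 1); [|lra].
  apply Rmult_le_compat_l; [exact Hz0|]. rewrite <- (pow1 m). apply pow_incr. lra.
Qed.

Lemma has_expansion_spread (n : nat) (f : C -> C) (a : nat -> C) :
  (1 <= n)%nat -> has_expansion f a -> has_expansion (fun z => f (z ^ n)%C) (spread n a).
Proof.
  intros Hn Hf z Hz.
  assert (Hzn : in_disk (z ^ n)%C).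
  { unfold in_disk in *. generalize (in_disk_pow n z Hn Hz). lra. }
  specialize (Hf _ Hzn). apply (proj1 (is_pseries_C _ _ _)) in Hf. apply is_pseries_C.
  apply (filterlim_ext (fun N => psum a (z ^ n)%C (N / n))).
  { intros N. symmetry. now apply psum_spread. }
  apply (filterlim_comp _ _ _ (fun N => (N / n)%nat) (psum a (z ^ n)%C) _ eventually);
    [|exact Hf].
  intros P [M HM]. exists (M * n)%nat. intros N HN. apply HM.
  apply Nat.div_le_lower_bound; lia.
Qed.

(** * The extremal function *)

(* [z (1 - e z ^ n) ^ (- beta)] *)
Definition extremal (n : nat) (beta e : R) (z : C) : C :=
  (z * binom_fun beta e (z ^ n))%C.

Lemma pow_in_disk (n : nat) (z : C) : (1 <= n)%nat -> in_disk z -> in_disk (z ^ n)%C.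
Proof. intros Hn Hz. generalize (in_disk_pow n z Hn Hz). unfold in_disk in *. lra. Qed.

Lemma is_Cderive_extremal (n : nat) (beta e : R) (z : C) :
  (1 <= n)%nat -> 0 <= e <= 1 -> in_disk z ->
  is_Cderive (extremal n beta e) z
    (binom_fun beta e (z ^ n) + z * (RtoC (INR n) * z ^ (n - 1) * binom_fun' beta e (z ^ n)))%C.
Proof.
  intros Hn He Hz.
  eapply is_Cderive_eq.
  - apply (is_Cderive_mult (fun y => y) (fun y => binom_fun beta e (y ^ n)%C));
      [apply is_Cderive_id|].
    apply (is_Cderive_comp (binom_fun beta e) (fun y => y ^ n)%C); [|apply is_Cderive_pow].
    apply is_Cderive_binom; [exact He | now apply pow_in_disk].
  - cbv beta. ring.
Qed.

Lemma class_A_extremal (n : nat) (beta e : R) :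
  (1 <= n)%nat -> 0 <= e <= 1 -> class_A n (extremal n beta e).
Proof.
  intros Hn He. split.
  - intros z Hz. eexists. now apply is_Cderive_extremal.
  - set (a := spread n (fun k => RtoC (binom_coef beta e k))).
    exists (PS_incr_1 (V := C_NormedModule) a).
    assert (Ha : has_expansion (fun z => binom_fun beta e (z ^ n)%C) a).
    { apply has_expansion_spread; [exact Hn|]. apply csum_correct. now apply binom_coef_bounded. }
    repeat split.
    + unfold PS_incr_1, a, spread. rewrite Nat.Div0.mod_0_l, Nat.Div0.div_0_l. reflexivity.
    + intros [|k] Hk; [lia|]. unfold PS_incr_1, a, spread.
      rewrite Nat.mod_small by lia. destruct (Nat.eq_dec k 0); [lia | reflexivity].
    + intros z Hz. exact (is_pseries_incr_1 (K := C_AbsRing) (V := C_NormedModule) a z _ (Ha z Hz)).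
Qed.

(** The logarithmic derivative is [1 + n x F' / F] with [x = z ^ n], and the differential equation
    makes it [1 + n e beta x / (1 - e x)]. The relations among the parameters turn the combined
    numerator into [1 + s c x]. *)
Lemma zf'_over_f_extremal (n : nat) (c d beta e s : R) (z : C) :
  (1 <= n)%nat -> 0 <= e <= 1 -> INR n * (e * beta) = s * (c - d) -> s * d = - e ->
  in_disk z ->
  zf'_over_f (extremal n beta e) z = mobius c d (RtoC s * z ^ n)%C.
Proof.
  intros Hn He Hb Hsd Hz.
  assert (Hzn := pow_in_disk n z Hn Hz).
  assert (Hden := one_minus_neq_0 e _ He Hzn).
  assert (Hdz : (RtoC d * (RtoC s * z ^ n) = - (RtoC e * z ^ n))%C).
  { transitivity (RtoC (s * d) * z ^ n)%C; [rewrite RtoC_mult; ring|].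
    rewrite Hsd, RtoC_opp. ring. }
  unfold mobius. rewrite Hdz. fold (Cminus 1 (RtoC e * z ^ n)).
  unfold zf'_over_f. destruct (Ceq_dec z (RtoC 0)) as [->|Hz0].
  - assert (H0 : (RtoC 0 ^ n = 0)%C) by (destruct n as [|m]; [lia | simpl; ring]).
    rewrite H0. field.
  - rewrite (C_derive_eq _ _ _ (is_Cderive_extremal n beta e z Hn He Hz)).
    assert (Ho := binom_fun_ode beta e _ He Hzn).
    assert (HF := binom_fun_neq_0 beta e _ He Hzn).
    unfold extremal.
    assert (Hpow : (z * z ^ (n - 1) = z ^ n)%C).
    { destruct n as [|m]; [lia|]. simpl. now rewrite Nat.sub_0_r. }
    set (F := binom_fun beta e (z ^ n)) in *. set (F' := binom_fun' beta e (z ^ n)) in *.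
    transitivity (((1 - RtoC e * z ^ n) * F
       + RtoC (INR n) * (z * z ^ (n - 1)) * ((1 - RtoC e * z ^ n) * F'))
       / ((1 - RtoC e * z ^ n) * F))%C; [field; auto|].
    rewrite Ho, Hpow.
    transitivity ((1 - RtoC e * z ^ n + RtoC (INR n * (e * beta)) * z ^ n)
       / (1 - RtoC e * z ^ n))%C; [rewrite !RtoC_mult; field; auto|].
    f_equal. rewrite Hb.
    replace (s * (c - d)) with (s * c + e) by lra.
    rewrite RtoC_plus, RtoC_mult. ring.
Qed.

Lemma geom_expansion (A e : R) (z : C) :
  0 <= e <= 1 -> in_disk z ->
  coef_bounded (fun k => RtoC (A * e ^ k)) /\
  ((1 - RtoC e * z) * csum (fun k => RtoC (A * e ^ k)) z = RtoC A)%C.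
Proof.
  intros He Hz.
  assert (Hb : coef_bounded (fun k => RtoC (A * e ^ k))).
  { intros s Hs. exists (Rabs A). intros k.
    rewrite Cmod_R, Rabs_mult, (Rabs_pos_eq (e ^ k)) by (apply pow_le; lra).
    rewrite Rmult_assoc, <- Rpow_mult_distr.
    assert (0 <= (e * s) ^ k <= 1).
    { split; [apply pow_le; nra|]. rewrite <- (pow1 k). apply pow_incr. nra. }
    generalize (Rabs_pos A). nra. }
  split; [exact Hb|].
  assert (H := csum_step _ z Hb Hz). cbv beta in H. rewrite pow_O, Rmult_1_r in H.
  assert (H2 : csum (fun k => RtoC (A * e ^ S k)) z
    = (RtoC e * csum (fun k => RtoC (A * e ^ k)) z + 0 * csum (fun k => RtoC (A * e ^ k)) z)%C).
  { rewrite <- (csum_linear _ _ _ _ z Hb Hb Hz). f_equal.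
    apply functional_extensionality. intros k. rewrite Cmult_0_l, Cplus_0_r, <- RtoC_mult.
    f_equal. simpl. ring. }
  rewrite H2 in H. set (M := csum (fun k => RtoC (A * e ^ k)) z) in *.
  transitivity (M - RtoC e * z * M)%C; [ring|]. rewrite H at 1. ring.
Qed.

Lemma class_S_extremal (n : nat) (c d beta e s : R) :
  (1 <= n)%nat -> 0 <= e <= 1 -> INR n * (e * beta) = s * (c - d) -> s * d = - e ->
  Rabs s = 1 -> class_S n c d (extremal n beta e).
Proof.
  intros Hn He Hb Hsd Hs.
  assert (Hzf := fun z => zf'_over_f_extremal n c d beta e s z Hn He Hb Hsd).
  assert (Hdz : forall z, (1 + RtoC d * (RtoC s * z) = 1 - RtoC e * z)%C).
  { intros z. transitivity (1 + RtoC (s * d) * z)%C; [rewrite RtoC_mult; ring|].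
    rewrite Hsd, RtoC_opp. ring. }
  assert (Hw : forall z, is_Cderive (fun y => RtoC s * y ^ n)%C z
                 (0 * z ^ n + RtoC s * (RtoC (INR n) * z ^ (n - 1)))%C).
  { intros z. apply (is_Cderive_mult (fun _ => RtoC s));
      [apply is_Cderive_const | apply is_Cderive_pow]. }
  assert (Hq : analytic_on_disk (zf'_over_f (extremal n beta e))).
  { intros z Hz. eexists.
    apply (is_Cderive_ext_disk (fun y => mobius c d (RtoC s * y ^ n))%C); [exact Hz| |].
    - intros y Hy. symmetry. now apply Hzf.
    - unfold mobius.
      apply (is_Cderive_div (fun y => 1 + RtoC c * (RtoC s * y ^ n))%C
                            (fun y => 1 + RtoC d * (RtoC s * y ^ n))%C).
      + apply (is_Cderive_plus (fun _ => RtoC 1)); [apply is_Cderive_const|].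
        apply (is_Cderive_mult (fun _ => RtoC c)); [apply is_Cderive_const | apply Hw].
      + apply (is_Cderive_plus (fun _ => RtoC 1)); [apply is_Cderive_const|].
        apply (is_Cderive_mult (fun _ => RtoC d)); [apply is_Cderive_const | apply Hw].
      + rewrite Hdz. apply one_minus_neq_0; [exact He | now apply pow_in_disk]. }
  split; [now apply class_A_extremal|]. split.
  - split; [|exact Hq]. intros z Hz Hz0. unfold extremal. apply Cmult_neq_0; [exact Hz0|].
    apply binom_fun_neq_0; [exact He | now apply pow_in_disk].
  - split; [exact Hq|]. split.
    (* [mobius c d (s x) = 1 + A x / (1 - e x)], so its coefficients [g] are 1 followed by the
       geometric sequence [A e ^ k]. *)
    + set (A := s * (c - d)).
      set (M := fun k => RtoC (A * e ^ k)).
      assert (H0 : in_disk 0) by (unfold in_disk; rewrite Cmod_0; lra).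
      assert (HM : coef_bounded M) by apply (geom_expansion A e 0 He H0).
      set (g := fun k => match k with O => RtoC 1 | S k => M k end).
      assert (Hg : coef_bounded g).
      { intros t Ht. destruct (HM t Ht) as [K HK]. exists (Rmax 1 K). intros [|k].
        - simpl. rewrite Cmod_1, Rmult_1_l. apply Rmax_l.
        - eapply Rle_trans; [|apply Rmax_r]. eapply Rle_trans; [|apply (HK k)].
          apply Rmult_le_compat_l; [apply Cmod_ge_0|]. simpl.
          assert (0 <= t ^ k) by (apply pow_le; lra). nra. }
      exists (spread n g). split; [|split].
      * unfold spread. rewrite Nat.Div0.mod_0_l, Nat.Div0.div_0_l. reflexivity.
      * intros k Hk. unfold spread. rewrite Nat.mod_small by lia.
        destruct (Nat.eq_dec k 0); [lia | reflexivity].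
      * intros z Hz. rewrite (Hzf z Hz).
        assert (Hzn := pow_in_disk n z Hn Hz).
        assert (Hsp := has_expansion_spread n _ g Hn (csum_correct g Hg) z Hz).
        cbv beta in Hsp.
        replace (mobius c d (RtoC s * z ^ n)%C) with (csum g (z ^ n)%C); [exact Hsp|].
        rewrite (csum_step g _ Hg Hzn).
        change (csum (fun k => g (S k)) (z ^ n)%C) with (csum M (z ^ n)%C).
        destruct (geom_expansion A e _ He Hzn) as [_ HG]. fold M in HG.
        assert (Hden := one_minus_neq_0 e _ He Hzn).
        unfold mobius. rewrite Hdz.
        transitivity ((1 - RtoC e * z ^ n + z ^ n * ((1 - RtoC e * z ^ n) * csum M (z ^ n)%C))
           / (1 - RtoC e * z ^ n))%C; [simpl g; field; exact Hden|].
        rewrite HG. f_equal. unfold A.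
        replace (s * (c - d)) with (s * c + e) by lra.
        rewrite RtoC_plus, RtoC_mult. ring.
    + exists (fun z => RtoC s * z ^ n)%C. repeat split.
      * intros z Hz. eexists. apply Hw.
      * destruct n as [|m]; [lia|]. simpl. ring.
      * intros z Hz. rewrite Cmod_mult, Cmod_R, Hs, Rmult_1_l. now apply in_disk_pow.
      * exact Hzf.
Qed.

(** * Sharpness and the value of the radius *)

Lemma Rpower_root_pow (n : nat) (x : R) :
  (1 <= n)%nat -> 0 < x -> Rpower x (1 / INR n) ^ n = x.
Proof.
  intros Hn Hx. apply le_INR in Hn. simpl in Hn.
  rewrite <- Rpower_pow by apply exp_pos. rewrite Rpower_mult.
  replace (1 / INR n * INR n) with 1 by (field; lra). now apply Rpower_1.
Qed.

Lemma pow_lt_reg (n : nat) (x y : R) : 0 <= y -> x ^ n < y ^ n -> x < y.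
Proof.
  intros Hy H. destruct (Rlt_le_dec x y) as [Hl|Hl]; [exact Hl|].
  assert (y ^ n <= x ^ n) by (apply pow_incr; lra). lra.
Qed.

(** Otherwise some real [t < 1] still violates the bound with [r t] in place of [r]. There the
    extremal quotient equals [1 + s y] with [y > arcsinh 1], and [Casinh_real] forces
    [|w t| = sinh y > 1], against [|w t| <= t]. *)
Lemma radius_property_upper (n : nat) (c d e s r : R) :
  (1 <= n)%nat -> d < c -> 0 < e <= 1 -> s * d = - e -> (s = 1 \/ s = -1) -> 0 < r <= 1 ->
  radius_property (class_S_rho_n n) (class_S n c d) r ->
  (c - d + arcsinh 1 * e) * r ^ n <= arcsinh 1.
Proof.
  intros Hn Hcd He Hsd Hs Hr Hrad.
  assert (Ha := arcsinh_1_pos).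
  assert (HL : 0 < c - d + arcsinh 1 * e) by nra.
  assert (Hrn : 0 < r ^ n) by (apply pow_lt; lra).
  apply Rnot_lt_le. intros Hlt.
  set (L := c - d + arcsinh 1 * e) in *.
  (* The midpoint between the critical ratio and 1: with [t ^ n = q], [t] stays below 1 while
     [L (r t) ^ n] stays above [arcsinh 1]. *)
  set (q := (1 + arcsinh 1 / (L * r ^ n)) / 2).
  assert (HLr : 0 < L * r ^ n) by nra.
  assert (Hq0 : 0 < arcsinh 1 / (L * r ^ n) < 1).
  { split; [now apply Rdiv_lt_0_compat | apply (Rlt_div_l _ _ (L * r ^ n)); lra]. }
  set (t := Rpower q (1 / INR n)).
  assert (Htn : t ^ n = q) by (apply Rpower_root_pow; [exact Hn | unfold q; lra]).
  assert (Ht0 : 0 < t) by apply exp_pos.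
  assert (Ht1 : t < 1).
  { apply (pow_lt_reg n); [lra|]. rewrite pow1, Htn. unfold q. lra. }
  set (x := (r * t) ^ n).
  assert (Hrt : 0 < r * t < 1) by nra.
  assert (Hx : 0 < x < 1).
  { split; [apply pow_lt; lra|]. unfold x. destruct n as [|m]; [lia|].
    apply pow_lt_1_compat; [lra | lia]. }
  assert (HLx : arcsinh 1 < L * x).
  { unfold x. rewrite Rpow_mult_distr, Htn.
    assert (Hqq : arcsinh 1 / (L * r ^ n) < q) by (unfold q; lra).
    apply (Rmult_lt_compat_r (L * r ^ n)) in Hqq; [|exact HLr].
    replace (arcsinh 1 / (L * r ^ n) * (L * r ^ n)) with (arcsinh 1) in Hqq
      by (field; split; lra).
    lra. }
  set (beta := s * (c - d) / (INR n * e)).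
  assert (Hn' : 1 <= INR n) by (apply le_INR in Hn; exact Hn).
  assert (Hb : INR n * (e * beta) = s * (c - d)) by (unfold beta; field; split; lra).
  assert (Habs : Rabs s = 1).
  { destruct Hs as [->| ->]; [apply Rabs_R1 | rewrite Rabs_left; lra]. }
  assert (HS := class_S_extremal n c d beta e s Hn ltac:(lra) Hb Hsd Habs).
  destruct (Hrad _ HS r ltac:(lra)) as (_ & _ & _ & (w & _ & _ & Hw & Hsub)).
  assert (Hz : in_disk (RtoC t)).
  { unfold in_disk. rewrite Cmod_R, Rabs_pos_eq; lra. }
  specialize (Hw _ Hz). specialize (Hsub _ Hz).
  destruct HS as ((Hf & _) & (Hf0 & _) & _).
  rewrite zf'_over_f_dilate in Hsub; [|exact Hr | exact Hz | exact Hf | exact Hf0].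
  rewrite (zf'_over_f_extremal n c d beta e s) in Hsub;
    [|exact Hn | lra | exact Hb | exact Hsd | now apply in_disk_scale].
  rewrite <- RtoC_mult, <- RtoC_pow in Hsub. fold x in Hsub.
  set (y := (c - d) * x / (1 - e * x)).
  assert (Hex : 0 < 1 - e * x) by nra.
  assert (Hy : arcsinh 1 < y).
  { unfold y. apply (Rlt_div_r _ _ (1 - e * x)); [exact Hex|]. unfold L in HLx. lra. }
  assert (HA : Casinh (w (RtoC t)) = RtoC (s * y)).
  { unfold one_plus_asinh in Hsub.
    transitivity (mobius c d (RtoC s * RtoC x) - 1)%C; [rewrite Hsub; ring|].
    unfold mobius, y.
    assert (Hden : RtoC (1 - e * x) <> RtoC 0) by (apply RtoC_neq_0; lra).
    replace (1 + RtoC d * (RtoC s * RtoC x))%C with (RtoC (1 - e * x)).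
    2:{ replace (1 - e * x) with (1 + s * d * x) by (rewrite Hsd; ring).
        rewrite RtoC_plus, !RtoC_mult. ring. }
    replace (s * ((c - d) * x / (1 - e * x))) with ((1 + c * (s * x) - (1 - e * x)) / (1 - e * x)).
    2:{ replace e with (- (s * d)) by lra. field. nra. }
    set (E := 1 - e * x) in *.
    rewrite RtoC_div by lra. rewrite RtoC_minus, RtoC_plus, !RtoC_mult.
    field. exact Hden. }
  apply Casinh_real in HA. rewrite HA, Cmod_R in Hw.
  rewrite Cmod_R, (Rabs_pos_eq t) in Hw by lra.
  assert (Hsy : 1 < sinh y) by (rewrite <- (sinh_arcsinh 1); now apply sinh_lt).
  assert (Hsinh : Rabs (sinh (s * y)) = sinh y).
  { destruct Hs as [->| ->].
    - rewrite Rmult_1_l. apply Rabs_pos_eq. lra.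
    - replace (sinh (-1 * y)) with (- sinh y).
      + rewrite Rabs_Ropp. apply Rabs_pos_eq. lra.
      + unfold sinh. replace (-1 * y) with (- y) by ring. rewrite Ropp_involutive. field. }
  lra.
Qed.

(** With denominators cleared, the critical condition is linear in [x = r ^ n]:
    [(c - d + arcsinh 1 * |d|) x <= arcsinh 1]. The minimum with 1 covers the case where it holds on
    the whole range of [r]. *)
Lemma is_radius_root (n : nat) (c d s : R) :
  (1 <= n)%nat -> d < c -> 0 < Rabs d <= 1 -> s * d = - Rabs d -> (s = 1 \/ s = -1) ->
  is_radius (class_S_rho_n n) (class_S n c d)
    (Rmin 1 (Rpower (arcsinh 1 / (c - d + arcsinh 1 * Rabs d)) (1 / INR n))).
Proof.
  intros Hn Hcd He Hsd Hs.
  assert (Ha := arcsinh_1_pos).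
  set (L := c - d + arcsinh 1 * Rabs d).
  assert (HL : 0 < L) by (unfold L; nra).
  assert (HX : 0 < arcsinh 1 / L) by now apply Rdiv_lt_0_compat.
  set (rho := Rpower (arcsinh 1 / L) (1 / INR n)).
  assert (Hrho : 0 < rho) by apply exp_pos.
  assert (Hpow : rho ^ n = arcsinh 1 / L) by now apply Rpower_root_pow.
  assert (Hmin : 0 < Rmin 1 rho <= 1) by (split; [apply Rmin_glb_lt; lra | apply Rmin_l]).
  split; [split; [exact Hmin|]|].
  - apply radius_property_S_rho; [exact Hn | exact Hcd | | exact Hmin |].
    + apply Rabs_le_between. lra.
    + assert (Hle : Rmin 1 rho ^ n <= arcsinh 1 / L).
      { rewrite <- Hpow. apply pow_incr. split; [lra | apply Rmin_r]. }
      apply (Rle_div_r _ _ L HL) in Hle. unfold L in Hle. lra.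
  - intros r Hr Hrad. apply Rmin_glb; [lra|].
    assert (Hup := radius_property_upper n c d (Rabs d) s r Hn Hcd He Hsd Hs Hr Hrad).
    fold L in Hup. apply Rnot_lt_le. intros Hlt.
    assert (Hlt' : rho ^ n < r ^ n).
    { assert (Hle : rho ^ n <= r ^ n) by (apply pow_incr; lra).
      destruct Hle as [H|H]; [exact H|]. exfalso.
      apply (Rlt_irrefl rho).
      assert (Hr' : Rpower (rho ^ n) (1 / INR n) = Rpower (r ^ n) (1 / INR n)) by now rewrite H.
      apply le_INR in Hn. simpl in Hn.
      rewrite <- !Rpower_pow, !Rpower_mult in Hr' by lra.
      replace (INR n * (1 / INR n)) with 1 in Hr' by (field; lra).
      rewrite !Rpower_1 in Hr' by lra. lra. }
    rewrite Hpow in Hlt'. apply (Rmult_lt_compat_r L) in Hlt'; [|exact HL].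
    replace (arcsinh 1 / L * L) with (arcsinh 1) in Hlt' by (field; lra). lra.
Qed.

Theorem theorem4p5 :
  forall (n : nat) (c d : R),
    (1 <= n)%nat ->
    (-1 <= d /\ d < 0 /\ 0 < c /\ c <= 1 ->
       is_radius (class_S_rho_n n) (class_S n c d) (Rmin 1 (rho_R1 n c d))) /\
    (0 < d /\ d < c /\ c <= 1 ->
       is_radius (class_S_rho_n n) (class_S n c d) (Rmin 1 (rho_R2 n c d))).
Proof.
  intros n c d Hn. assert (Ha := arcsinh_1_pos). split.
  - intros (Hd1 & Hd2 & Hc1 & Hc2).
    assert (Habs : Rabs d = - d) by (apply Rabs_left; exact Hd2).
    replace (rho_R1 n c d)
      with (Rpower (arcsinh 1 / (c - d + arcsinh 1 * Rabs d)) (1 / INR n)).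
    + apply (is_radius_root n c d 1); rewrite ?Habs; try lra; auto.
    + unfold rho_R1. f_equal. rewrite Habs.
      replace ((c - d) ^ 2 + 4 * (d ^ 2 * (1 + arcsinh 1) - c * d) * arcsinh 1)
        with ((c - d - 2 * arcsinh 1 * d) ^ 2) by ring.
      (* The denominator becomes twice [c - d - arcsinh 1 * d], which cancels the 2 in the
         numerator. *)
      rewrite sqrt_pow2 by nra. field. nra.
  - intros (Hd1 & Hd2 & Hc).
    assert (Habs : Rabs d = d) by (apply Rabs_pos_eq; lra).
    replace (rho_R2 n c d)
      with (Rpower (arcsinh 1 / (c - d + arcsinh 1 * Rabs d)) (1 / INR n)).
    + apply (is_radius_root n c d (-1)); rewrite ?Habs; try lra; auto.
    + unfold rho_R2. f_equal. rewrite Habs.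
      replace ((c - d) ^ 2 + 4 * (d ^ 2 * (arcsinh 1 - 1) + c * d) * arcsinh 1)
        with ((c - d + 2 * arcsinh 1 * d) ^ 2) by ring.
      rewrite sqrt_pow2 by nra. field. nra.
Qed.
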